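(* There exist a positive integer $d$ and a finite set $\mathcal{D}\subset\mathbb{Z}^d$, each of whose vectors has positive coordinate sum, such that every algorithm (deterministic Turing machine) recognizing the language $\mathcal{P}(\mathcal{D})$ has worst-case running time $T(n)=\Omega(2^{n/11})$, where $n$ is the input length.
   Context: A $d$-dimensional subtraction game (MSG) is given by a finite difference set $D\subset\mathbb{Z}^d$ such that every $a\in D$ satisfies $\sum_{i=1}^d a_i>0$. Positions are vectors $x\in\mathbb{Z}_{\ge 0}^d$; a move from $x$ to $y$ is allowed iff $y\in\mathbb{Z}_{\ge0}^d$ and $x-y\in D$. Two players alternate moves; a player unable to move loses (normal play). A position is a P-position if the player to move has no winning strategy, and an N-position otherwise. $\mathcal{P}(D)$ denotes the language of binary representations (under a standard binary encoding of the tuple $(x_1,\dots,x_d)$) of all P-positions of the game with difference set $D$. *)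

(* Defs.v *)
From HB Require Import structures.
From mathcomp Require Import all_boot all_order all_algebra.
Set Implicit Arguments. Unset Strict Implicit. Unset Printing Implicit Defensive.
Import Order.TTheory GRing.Theory Num.Theory.

Definition position (d : nat) := {ffun 'I_d -> nat}.
Definition diffvec (d : nat) := {ffun 'I_d -> int}.

Definition valid_diffset (d : nat) (D : seq (diffvec d)) : Prop :=
  forall a, a \in D -> (0 < \sum_(i < d) a i)%R.

Definition game_move (d : nat) (D : seq (diffvec d)) (x y : position d) : Prop :=
  exists2 a, a \in D & forall i : 'I_d, ((x i)%:Z - (y i)%:Z)%R = a i.

(* P-positions (player to move loses) and N-positions, normal play.
   Every play is finite (coordinate sum strictly decreases), so the
   inductive characterisation coincides with "the player to move has no
   winning strategy". *)
Inductive Ppos (d : nat) (D : seq (diffvec d)) : position d -> Prop :=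
  | Ppos_intro x : (forall y, game_move D x y -> Npos D y) -> Ppos D x
with Npos (d : nat) (D : seq (diffvec d)) : position d -> Prop :=
  | Npos_intro x y : game_move D x y -> Ppos D y -> Npos D x.

(* alphabet: Some false = '0', Some true = '1', None = separator '#'    *)

Fixpoint bin_aux (fuel n : nat) : seq bool :=
  match fuel with
  | 0 => [::]
  | f.+1 => if n == 0 then [::] else rcons (bin_aux f n./2) (odd n)
  end.

(* binary representation, most significant bit first, no leading zeros;
   0 is written "0" *)
Definition bin (n : nat) : seq bool := if n == 0 then [:: false] else bin_aux n n.

Fixpoint sep_join (s : seq (seq (option bool))) : seq (option bool) :=
  match s with
  | [::] => [::]
  | [:: w] => w
  | w :: s' => w ++ None :: sep_join s'
  end.

Definition encode (d : nat) (x : position d) : seq (option bool) :=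
  sep_join [seq map Some (bin (x i)) | i <- enum 'I_d].

Definition PLang (d : nat) (D : seq (diffvec d)) (w : seq (option bool)) : Prop :=
  exists x : position d, w = encode x /\ Ppos D x.

Inductive dir := MoveL | MoveR | Stay.

Definition dir_shift (m : dir) : int :=
  match m with MoveL => (-1)%R | MoveR => 1%R | Stay => 0%R end.

(* A machine over input alphabet Sigma with tm_k.+1 tapes (tape 0 holds
   the input), finite state set and finite tape alphabet. *)
Record TM (Sigma : finType) := {
  tm_k : nat;
  tm_state : finType;
  tm_gamma : finType;
  tm_blank : tm_gamma;
  tm_input : Sigma -> tm_gamma;
  tm_start : tm_state;
  tm_acc : tm_state;
  tm_rej : tm_state;
  tm_delta : tm_state -> {ffun 'I_tm_k.+1 -> tm_gamma} ->
             tm_state * {ffun 'I_tm_k.+1 -> tm_gamma * dir}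
}.

Section TMSemantics.
Variable Sigma : finType.
Variable M : TM Sigma.

Definition config : Type :=
  (tm_state M * ('I_(tm_k M).+1 -> int -> tm_gamma M) * ('I_(tm_k M).+1 -> int))%type.

Definition halted_state (s : tm_state M) : bool := (s == tm_acc M) || (s == tm_rej M).

Definition halted (c : config) : bool := halted_state c.1.1.

Definition init_config (w : seq Sigma) : config :=
  (tm_start M,
   fun i z => if (i == ord0) then
                match z with
                | Posz n => if n < size w then
                              match ohead (drop n w) with
                              | Some a => tm_input M a
                              | None => tm_blank M end
                            else tm_blank M
                | Negz _ => tm_blank M
                end
              else tm_blank M,
   fun _ => 0%R).

Definition step (c : config) : config :=
  let: (s, tapes, heads) := c in
  if halted_state s then c else
  let: (s', out) := tm_delta s [ffun i => tapes i (heads i)] in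
  (s',
   fun i z => if z == heads i then (out i).1 else tapes i z,
   fun i => (heads i + dir_shift (out i).2)%R).

Definition run (w : seq Sigma) (t : nat) : config := iter t step (init_config w).

Definition decides (L : seq Sigma -> Prop) : Prop :=
  forall w, (exists t, halted (run w t)) /\
            (L w <-> exists t, (run w t).1.1 = tm_acc M).

End TMSemantics.

(* Main.v *)
Require Import Defs.
From HB Require Import structures.
From mathcomp Require Import all_boot all_order all_algebra.
From mathcomp Require Import zify.

Set Implicit Arguments.
Unset Strict Implicit.
Unset Printing Implicit Defensive.

Import Order.TTheory GRing.Theory Num.Theory.

(** A position is a P-position iff all its options are N-positions, so a game
    evaluates a translation-invariant NOR recursion on the orthant.  Adding
    one-hot coordinates for the states of a finite control turns such a game into
    a program with natural-number registers whose instructions are NORs of other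
    instructions and zero-test branches; one more coordinate ("fuel") decreases at
    every step and pays for all other increments, so that every difference vector
    has positive sum.

    One fixed program is an interpreter for arbitrary finite NOR networks over
    space-time [nat * int]: the wiring of the network is read off the leading
    binary digits of a number [y].  For a machine [M], the run of [M] on an input
    is itself such a network, of linear depth in the running time, and the
    network may read [y] as input word.  Hence a position [Y = 2 ^ omega * y] can
    be made to ask whether [M] rejects the very encoding of that position.  The
    trailing digits of [y] are free padding, so this happens at every large
    length [n].  The only limit is the fuel, which is about [y], i.e. [2 ^ n] up
    to a constant, while simulating [t] steps costs [O(t ^ 2)]; if [M] halts within
    [t] steps with [t ^ 11] much smaller than [2 ^ n], its answer is wrong. *)

(** * Counter programs as subtraction games *)

Scheme Ppos_mind := Minimality for Ppos Sort Prop
  with Npos_mind := Minimality for Npos Sort Prop.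

Lemma Ppos_not_Npos d (D : seq (diffvec d)) x : Ppos D x -> ~ Npos D x.
Proof.
apply: (@Ppos_mind d D (fun x => ~ Npos D x) (fun x => ~ Ppos D x)) => {x}.
- by move=> x _ IH Nx; case: Nx IH => {}x y xy Py /(_ y xy).
- by move=> x y xy _ IH Px; case: Px xy => {}x H /H.
Qed.

Definition amt (v : seq (nat * nat)) (i : nat) : nat :=
  foldr (fun p acc => (if p.1 == i then p.2 else 0) + acc) 0 v.

Definition fits R (v : seq (nat * nat)) (X : seq nat) : bool :=
  all (fun i => amt v i <= nth 0 X i) (iota 0 R).

Definition shift R (v w : seq (nat * nat)) (X : seq nat) : seq nat :=
  mkseq (fun i => nth 0 X i - amt v i + amt w i) R.

Definition delta := (seq (nat * nat) * seq (nat * nat))%type.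

Section CounterGames.

(* [F] is the amount of fuel consumed by one move; below, fuel is counted in
   units of [F]. *)
Variables (label : finType) (R F : nat).

(* [Nor ms] is the NOR of the instructions in [ms], each evaluated after the given
   register change and dropped when a register would become negative.
   [Branch u k p1 p2] has the value of [p1] after the change [u], gaining [k]
   units of fuel, when [u] is possible, and the value of [p2] otherwise. *)
Inductive instr :=
  | Nor of seq (delta * label)
  | Branch of delta & nat & label & label.

Variable prog : label -> instr.

Definition update (u : delta) (X : seq nat) : option (seq nat) :=
  if fits R u.1 X then Some (shift R u.1 u.2 X) else None.

(* [ev n p X b]: instruction [p] on registers [X] has value [b], and this is
   certified by a part of the play that needs [n] units of fuel. *)
Inductive ev : nat -> label -> seq nat -> bool -> Prop :=
  | ev_nor_true n p X ms : prog p = Nor ms ->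
      (forall m X', m \in ms -> update m.1 X = Some X' -> ev n m.2 X' false) ->
      ev n.+1 p X true
  | ev_nor_false n p X ms m X' : prog p = Nor ms -> m \in ms ->
      update m.1 X = Some X' -> ev n m.2 X' true -> ev n.+1 p X false
  | ev_branch_then n p X u k p1 p2 X' b : prog p = Branch u k p1 p2 ->
      update u X = Some X' -> ev (n + k) p1 X' b -> ev (n + 6) p X b
  | ev_branch_else n p X u k p1 p2 b : prog p = Branch u k p1 p2 ->
      update u X = None -> ev n p2 X b -> ev (n + 6) p X b.

Lemma ev_mono n m p X b : n <= m -> ev n p X b -> ev m p X b.
Proof.
move=> nm H; elim: H m nm => {n p X b}.
- move=> n p X ms Hp _ IH [//|m] nm; apply: (ev_nor_true Hp) => u X' um uX.
  exact: IH.
- move=> n p X ms u X' Hp um uX _ IH [//|m] nm.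
  by apply: (ev_nor_false Hp um uX); apply: IH.
- move=> n p X u k p1 p2 X' b Hp uX _ IH m nm.
  rewrite -(subnK (leq_trans (leq_addl n 6) nm)).
  by apply: (ev_branch_then Hp uX); apply: IH; lia.
- move=> n p X u k p1 p2 b Hp uX _ IH m nm.
  rewrite -(subnK (leq_trans (leq_addl n 6) nm)).
  by apply: (ev_branch_else Hp uX); apply: IH; lia.
Qed.

(* A branch is made of six NOR gates:
     0 = NOR (1 after u) 2,  1 = NOR p1,  2 = NOR 3 p2,
     3 = NOR 4,  4 = NOR (5 after the decrements of u),  5 = NOR of nothing,
   so that gate 3 tells whether [u] is possible. *)
Definition gate := (label * 'I_6)%type.
Definition gmove := (delta * nat * gate)%type.

Definition free_move (g : gate) : gmove := (([::], [::]), 0, g).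

Definition sub (k : nat) : 'I_6 := inord k.

Definition moves_from (g : gate) : seq gmove :=
  match prog g.1, val g.2 with
  | Nor ms, 0 => [seq (m.1, 0, (m.2, sub 0)) | m <- ms]
  | Branch u k _ _, 0 => [:: (u, k, (g.1, sub 1)); free_move (g.1, sub 2)]
  | Branch _ _ p1 _, 1 => [:: free_move (p1, sub 0)]
  | Branch _ _ _ p2, 2 => [:: free_move (g.1, sub 3); free_move (p2, sub 0)]
  | Branch _ _ _ _, 3 => [:: free_move (g.1, sub 4)]
  | Branch u _ _ _, 4 => [:: ((u.1, [::]), 0, (g.1, sub 5))]
  | _, _ => [::]
  end.

Definition game_dim : nat := R.+1 + #|{: gate}|.

Definition gidx (g : gate) : nat := R.+1 + enum_rank g.

Lemma gidx_lt g : gidx g < game_dim.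
Proof. by rewrite /gidx /game_dim ltn_add2l. Qed.

Lemma gidx_inj : injective gidx.
Proof. by move=> g h /addnI /val_inj /enum_rank_inj. Qed.

Lemma gidx_nreg g i : i <= R -> (i == gidx g) = false.
Proof. by rewrite /gidx => iR; apply/eqP; lia. Qed.

(* Coordinates: the registers, the fuel, then a one-hot code of the gate.  A move
   leaving a gate other than [g] would need a negative coordinate, provided no
   gate moves to itself. *)
Definition pos (g : gate) (X : seq nat) (f : nat) : position game_dim :=
  [ffun i : 'I_game_dim => (if i < R then nth 0 X i else 0)
     + (if i == R :> nat then f else 0) + (i == gidx g :> nat)].

Definition vec (g : gate) (m : gmove) : diffvec game_dim :=
  [ffun i : 'I_game_dim =>
     (if (i < R)%N then (amt m.1.1.1 i)%:Z - (amt m.1.1.2 i)%:Z else 0)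
     + (if i == R :> nat then F%:Z - (m.1.2 * F)%:Z else 0)
     + ((i == gidx g :> nat)%:Z - (i == gidx m.2 :> nat)%:Z)]%R.

Definition diffs : seq (diffvec game_dim) :=
  [seq vec g m | g <- enum {: gate}, m <- moves_from g].

(** A difference vector only records what is added minus what is subtracted, so disjoint supports
    are what makes nonnegativity of the target equivalent to [fits]. The inequality says that
    registers and fuel together decrease. *)
Definition balanced (u : delta) (k : nat) : Prop :=
  (forall i, i < R -> amt u.1 i = 0 \/ amt u.2 i = 0) /\
  \sum_(i < R) amt u.2 i + k * F < \sum_(i < R) amt u.1 i + F.

Definition balanced_instr (c : instr) : Prop :=
  match c with
  | Nor ms => forall m, m \in ms -> balanced m.1 0
  | Branch u k _ _ => balanced u k
  end.

(** A branch may jump to its own label: gates 1 and 2 lie in between, so no gate moves to itself. *)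
Definition loopfree (p : label) : Prop :=
  if prog p is Nor ms then forall m, m \in ms -> m.2 != p else True.

Definition balancedb (u : delta) (k : nat) : bool :=
  all (fun i => (amt u.1 i == 0) || (amt u.2 i == 0)) (iota 0 R)
  && (sumn [seq amt u.2 i | i <- iota 0 R] + k * F
      < sumn [seq amt u.1 i | i <- iota 0 R] + F).

Lemma balancedP u k : balancedb u k -> balanced u k.
Proof.
have sumE v : sumn [seq amt v i | i <- iota 0 R] = \sum_(i < R) amt v i.
  by rewrite sumnE big_map -(big_mkord xpredT) /index_iota subn0.
rewrite /balancedb !sumE => /andP[/allP dj lt_inc]; split=> // i iR.
have := dj i; rewrite mem_iota iR => /(_ isT)/orP[]/eqP; first by left.
by right.
Qed.

Hypothesis F_gt0 : 0 < F.
Hypothesis prog_balanced : forall p, balanced_instr (prog p).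
Hypothesis prog_loopfree : forall p, loopfree p.

Lemma balanced0 : balanced ([::], [::]) 0.
Proof. by split=> [|/=]; [left | rewrite !big1_eq]. Qed.

Lemma moves_balanced g m : m \in moves_from g -> balanced m.1.1 m.1.2.
Proof.
case: g => p k; rewrite /moves_from /=; have := prog_balanced p.
case: (prog p) => [ms|u c p1 p2] /= H.
  by case: (val k) => [|?] //= /mapP[x /H xb ->].
have H5 : balanced (u.1, [::]) 0 by split=> [|/=]; [right | rewrite big1_eq; lia].
have H0 := balanced0.
by case: (val k) => [|[|[|[|[|?]]]]] //=; rewrite !inE;
  do ?[case/orP]; move/eqP->.
Qed.

Lemma moves_target g m : m \in moves_from g -> m.2 != g.
Proof.
case: g => p k; rewrite /moves_from /=; have := prog_loopfree p.
rewrite /loopfree.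
case: (prog p) => [ms|u c p1 p2] /= H.
  case: (val k) => [|?] //= /mapP[x /H xb ->] /=.
  by apply: contra xb => /eqP[-> _].
have E i : i < 6 -> i != val k -> sub i != k.
  move=> i6; apply: contraNneq => <-; rewrite /sub /=. by rewrite inordK.
case Ek: (val k) => [|[|[|[|[|?]]]]] //=; rewrite !inE;
  do ?[case/orP]; move/eqP-> => /=; rewrite xpair_eqE negb_and E ?orbT ?Ek //.
Qed.

Lemma sum_gidx g : \sum_(i < game_dim) (i == gidx g :> nat) = 1.
Proof.
rewrite (bigD1 (Ordinal (gidx_lt g))) //= eqxx big1 // => i.
by rewrite -val_eqE /= => /negbTE->.
Qed.

Lemma Posz_sum n (f : 'I_n -> nat) :
  Posz (\sum_(i < n) f i) = (\sum_(i < n) Posz (f i))%R.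
Proof. exact: (big_morph Posz PoszD). Qed.

(** The one-hot codes of source and target cancel in the sum; what remains is registers plus
    fuel. *)
Lemma diffs_valid : valid_diffset diffs.
Proof.
move=> a /allpairsPdep[g [m [_ mg ->]]].
have := moves_balanced mg; move=> [_ B].
have RD : R < game_dim by rewrite /game_dim; lia.
have sumR (c : int) : (\sum_(i < game_dim) (if i == R :> nat then c else 0) = c)%R.
  rewrite (bigD1 (Ordinal RD)) //= eqxx big1 ?addr0 // => i.
  by rewrite -val_eqE /= => /negbTE->.
have sumregs (c : nat -> int) :
    (\sum_(i < game_dim) (if (i < R)%N then c i else 0) = \sum_(i < R) c i)%R.
  by rewrite (big_ord_widen _ c (ltnW RD)) -big_mkcond.
under eq_bigr do rewrite ffunE.
rewrite !big_split /= sumrN -!Posz_sum !sum_gidx subrr addr0 sumR.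
rewrite (sumregs (fun i => (amt m.1.1.1 i)%:Z - (amt m.1.1.2 i)%:Z)%R).
have aux (b c d e : nat) : b + d < c + e -> (0 < c%:Z - b%:Z + (e%:Z - d%:Z))%R.
  by lia.
by rewrite sumrB -!Posz_sum; apply: aux B.
Qed.

Lemma pos_subE g X f (z : position game_dim) (v w : seq (nat * nat)) (k : nat) g' :
  (forall i, i < R -> amt v i = 0 \/ amt w i = 0) ->
  (forall i, (pos g X f i)%:Z - (z i)%:Z = vec g ((v, w), k, g') i)%R ->
  exists X' f', [/\ update (v, w) X = Some X', f' + F = f + k * F
                  & z = pos g' X' f'].
Proof.
have RD : R < game_dim by rewrite /game_dim; lia.
move=> dj E.
have regE (i : nat) (iD : i < game_dim) : i < R ->
    amt v i <= nth 0 X i /\ z (Ordinal iD) = nth 0 X i - amt v i + amt w i.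
  move=> iR; have := E (Ordinal iD); have := dj i iR.
  rewrite !ffunE /= iR !gidx_nreg ?(ltnW iR) // (ltn_eqF iR).
  rewrite subrr !addr0 !addn0; move: (z _) => zi dji ziE. split; lia.
have fE : z (Ordinal RD) + F = f + k * F.
  have := E (Ordinal RD); rewrite !ffunE /= ltnn eqxx !gidx_nreg //; lia.
exists (shift R v w X), (z (Ordinal RD)); split => //.
  rewrite /update ifT //; apply/allP => i; rewrite mem_iota => /andP[_ iR].
  by have [] := regE i (ltn_trans iR RD) iR.
apply/ffunP => -[i iD]; rewrite !ffunE /=.
have [iR|iR|iR] := ltngtP i R.
- have [_ ->] := regE i iD iR.
  by rewrite gidx_nreg ?(ltnW iR) // nth_mkseq //= !addn0.
- have := E (Ordinal iD); rewrite !ffunE /= (gtn_eqF iR).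
  have -> : (i < R) = false by lia.
  by case: (i == _); case: (i == _); lia.
- subst i; rewrite gidx_nreg // addn0 add0n; congr (z _); exact: val_inj.
Qed.

Lemma game_moveP g X f z : game_move diffs (pos g X f) z ->
  exists2 m, m \in moves_from g &
    exists X' f', [/\ update m.1.1 X = Some X', f' + F = f + m.1.2 * F
                    & z = pos m.2 X' f'].
Proof.
case=> a /allpairsPdep[h [m [_ mh ->]]] E.
(* Otherwise coordinate [gidx h] of the position is 0 while the move lowers it by 1. *)
have gh : h = g.
  apply/eqP; apply: contraT => hg; have := E (Ordinal (gidx_lt h)).
  rewrite !ffunE /= eqxx !(inj_eq gidx_inj) (eq_sym h m.2).
  rewrite (negbTE (moves_target mh)) (negbTE hg).
  have -> : (gidx h < R) = false by rewrite /gidx; lia.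
  have -> : (gidx h == R) = false by rewrite /gidx; apply/eqP; lia.
  lia.
subst h; exists m => //.
have [dj _] := moves_balanced mh.
by case: m {mh} dj E => [[[v w] k] g'] /= dj /(pos_subE dj).
Qed.

Lemma game_moveI g (m : gmove) X X' f f' : m \in moves_from g ->
  update m.1.1 X = Some X' -> f' + F = f + m.1.2 * F ->
  game_move diffs (pos g X f) (pos m.2 X' f').
Proof.
case: m => [[[v w] k] g'] mg /=; rewrite /update /=.
case: ifP => // /allP vX [<-] fE; exists (vec g (v, w, k, g')).
  apply/allpairsPdep; exists g, (v, w, k, g'); split => //.
  by rewrite mem_enum.
move=> [i iD]; rewrite !ffunE /=.
have [iR|iR|iR] := ltngtP i R.
- have := vX i; rewrite mem_iota iR => /(_ isT) vi.
  by rewrite nth_mkseq // !gidx_nreg ?(ltnW iR) //; lia.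
- by case: (i == _); case: (i == _); lia.
- by subst i; rewrite !gidx_nreg //; lia.
Qed.

Definition value_at (b : bool) (x : position game_dim) : Prop :=
  if b then Ppos diffs x else Npos diffs x.

Lemma value_true g X f :
  (forall (m : gmove) X' f', m \in moves_from g -> update m.1.1 X = Some X' ->
     f' + F = f + m.1.2 * F -> value_at false (pos m.2 X' f')) ->
  value_at true (pos g X f).
Proof.
move=> H; apply: Ppos_intro => y /game_moveP[m mg [X' [f' [mX fE ->]]]].
exact: H mg mX fE.
Qed.

Lemma value_false g (m : gmove) X X' f f' : m \in moves_from g ->
  update m.1.1 X = Some X' -> f' + F = f + m.1.2 * F ->
  value_at true (pos m.2 X' f') -> value_at false (pos g X f).
Proof. move=> mg mX fE; apply: Npos_intro; exact: game_moveI mg mX fE. Qed.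

Lemma update_nil X : size X = R -> update ([::], [::]) X = Some X.
Proof.
move=> sX; rewrite /update ifT; last by apply/allP.
congr Some; apply: (@eq_from_nth _ 0); rewrite size_mkseq // => i iR.
by rewrite nth_mkseq //= subn0 addn0.
Qed.

Lemma size_update u X X' : update u X = Some X' -> size X' = R.
Proof. by rewrite /update; case: ifP => // _ [<-]; rewrite size_mkseq. Qed.

Lemma sub_val k : k < 6 -> val (sub k) = k.
Proof. by move=> k6; rewrite /= inordK. Qed.

(** Such a gate is a negation; [b] pairs its target with the value there. *)
Lemma value_free g X f b : size X = R -> moves_from g = [:: free_move b.1] ->
  F <= f -> value_at b.2 (pos b.1 X (f - F)) -> value_at (~~ b.2) (pos g X f).
Proof.
case: b => h b /= sX gE Ff hb; have mg : free_move h \in moves_from g by rewrite gE inE.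
case: b hb => hb.
  by apply: (value_false (f' := f - F) mg (update_nil sX)) => //=; lia.
apply: value_true => m X' f'; rewrite gE inE => /eqP-> /=.
rewrite update_nil // => -[<-] fE.
by have -> : f' = f - F by lia.
Qed.

Section Branching.

Variables (p p1 p2 : label) (u : delta) (k : nat) (X : seq nat) (f : nat).
Hypotheses (pE : prog p = Branch u k p1 p2) (sX : size X = R).

Let gateE i : i < 6 -> moves_from (p, sub i) = nth [::]
  [:: [:: (u, k, (p, sub 1)); free_move (p, sub 2)]; [:: free_move (p1, sub 0)];
      [:: free_move (p, sub 3); free_move (p2, sub 0)]; [:: free_move (p, sub 4)];
      [:: ((u.1, [::]), 0, (p, sub 5))]; [::]] i.
Proof.
move=> i6; rewrite /moves_from /fst pE sub_val //.
by case: i i6 => [|[|[|[|[|[|]]]]]].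
Qed.

Lemma gate5 h Z : value_at true (pos (p, sub 5) Z h).
Proof. by apply: value_true => m X' f'; rewrite gateE. Qed.

Lemma gate3 h : 3 * F <= h -> value_at (update u X : bool) (pos (p, sub 3) X h).
Proof.
move=> Fh; rewrite -[isSome _]negbK.
apply: (value_free (b := ((p, sub 4), _)) sX) => /=; [by rewrite gateE | lia |].
rewrite /update; case: ifP => ft /=.
  apply: (value_false (m := ((u.1, [::]), 0, (p, sub 5))) (f' := h - F - F)).
  - by rewrite gateE // inE.
  - by rewrite /update ft.
  - by rewrite /=; lia.
  - exact: gate5.
apply: value_true => m X' f'; rewrite gateE // inE => /eqP-> /=.
by rewrite /update ft.
Qed.

(** Gate 3 is true, so gate 2 is false and gate 0 is the double negation of [p1] after [u]. Six
    units of fuel cover the side test along gates 0, 2, 3, 4, 5. *)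
Lemma branch_then X' b : update u X = Some X' -> 6 * F <= f ->
  value_at b (pos (p1, sub 0) X' (f + k * F - F - F)) ->
  value_at b (pos (p, sub 0) X f).
Proof.
move=> uX Ff v1.
have v2 : value_at (~~ b) (pos (p, sub 1) X' (f + k * F - F)).
  apply: (value_free (b := ((p1, sub 0), b))) => //; last lia.
    exact: size_update uX.
  by rewrite gateE.
have mg : (u, k, (p, sub 1)) \in moves_from (p, sub 0) by rewrite gateE // inE eqxx.
case: b v1 v2 => v1 v2; last first.
  by apply: (value_false mg uX) v2 => /=; lia.
apply: value_true => m Z h; rewrite gateE // !inE => /orP[]/eqP-> /=.
  rewrite uX => -[<-] hE; have -> : h = f + k * F - F by lia.
  exact: v2.
rewrite update_nil // => -[<-] hE.
apply: (value_false (m := free_move (p, sub 3)) (f' := h - F) _ (update_nil sX)).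
- by rewrite gateE // inE eqxx.
- by rewrite /=; lia.
- have := @gate3 (h - F); rewrite uX; apply; lia.
Qed.

(** The move to gate 1 is blocked and gate 3 is false, so gate 0 is the double negation of [p2]. *)
Lemma branch_else b : update u X = None -> 6 * F <= f ->
  value_at b (pos (p2, sub 0) X (f - F - F)) ->
  value_at b (pos (p, sub 0) X f).
Proof.
move=> uX Ff v2.
have aX := update_nil sX.
have v1 : value_at (~~ b) (pos (p, sub 2) X (f - F)).
  case: b v2 => v2 /=.
    apply: (value_false (m := free_move (p2, sub 0)) _ aX _ v2).
    - by rewrite gateE // !inE eqxx orbT.
    - by rewrite /=; lia.
  apply: value_true => m Z h; rewrite gateE // !inE => /orP[]/eqP-> /=;
    rewrite aX => -[<-] hE; have -> : h = f - F - F by lia.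
  - by have := @gate3 (f - F - F); rewrite uX; apply; lia.
  - exact: v2.
case: b v1 v2 => v1 v2; last first.
  apply: (value_false (m := free_move (p, sub 2)) _ aX _ v1).
  - by rewrite gateE // !inE eqxx orbT.
  - by rewrite /=; lia.
apply: value_true => m Z h; rewrite gateE // !inE => /orP[]/eqP-> /=.
  by rewrite uX.
rewrite aX => -[<-] hE; have -> : h = f - F by lia.
exact: v1.
Qed.

End Branching.

(** Induction on the certificate; [n * F <= f] persists along it, so lack of fuel never blocks a
    move that the evaluation relies on. *)
Lemma ev_value n p X b f : ev n p X b -> size X = R -> n * F <= f ->
  value_at b (pos (p, sub 0) X f).
Proof.
move=> H; elim: H f => {n p X b}.
- move=> n p X ms pE _ IH f sX nf; apply: value_true => m X' f'.
  rewrite /moves_from /fst pE sub_val // => /mapP[m' m'ms ->] /= mX fE.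
  by apply: (IH m') => //; [exact: size_update mX | lia].
- move=> n p X ms m X' pE mms mX _ IH f sX nf.
  apply: (value_false (m := (m.1, 0, (m.2, sub 0))) (f' := f - F) _ mX).
  + rewrite /moves_from /fst pE sub_val //.
    by apply: (map_f (fun m => (m.1, 0, (m.2, sub 0)))).
  + by rewrite /=; lia.
  + by apply: IH; [exact: size_update mX | lia].
- move=> n p X u k p1 p2 X' b pE uX _ IH f sX nf.
  apply: (branch_then pE sX uX); first lia.
  by apply: IH; [exact: size_update uX | lia].
- move=> n p X u k p1 p2 b pE uX _ IH f sX nf.
  by apply: (branch_else pE sX uX); [lia | apply: IH => //; lia].
Qed.

End CounterGames.

(** * An interpreter for NOR networks *)

Inductive opcode :=
  | Nop | TimeInc | TimeDec | PosInc | PosDec | PosZero | IsZero | IsInside | IsOne.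

Definition opcodes :=
  [:: Nop; TimeInc; TimeDec; PosInc; PosDec; PosZero; IsZero; IsInside; IsOne].

(** Values 1 to 9 leave, modulo 16, residue 0 for edges and 10 for the flag of further
    candidates. *)
Definition opnum (o : opcode) : nat :=
  match o with
  | Nop => 1 | TimeInc => 2 | TimeDec => 3 | PosInc => 4 | PosDec => 5
  | PosZero => 6 | IsZero => 7 | IsInside => 8 | IsOne => 9
  end.

Lemma opnumK : cancel (fun o => (opnum o).-1) (nth Nop opcodes).
Proof. by case. Qed.

HB.instance Definition _ := Equality.copy opcode (can_type opnumK).

Inductive label :=
  | True_ | False_ | Setup
  | Node | More | NotBit | BitAddr | Edge | NotEdge | EdgeAddrJ | EdgeAddrL
  | Ops | Op of opcode
  | Goto | ClearJ | LoadJ | GotoZero | ClearA | ClearB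
  | NotZero | ZeroAB | ZeroA | ZeroB
  | NotInside | InsideAB | InsideB | InsideA
  | NotOne | OneAB | OneB | OneA
  | Bit | NotBitAt | LastBit | NotOdd | Odd | Positive | NotLong | Long
  | LongHalf | LongDrop | LongBack | NextBit | BitHalf | BitRound | BitBack.

Definition labels : seq label :=
  [:: True_; False_; Setup;
      Node; More; NotBit; BitAddr; Edge; NotEdge; EdgeAddrJ; EdgeAddrL; Ops;
      Goto; ClearJ; LoadJ; GotoZero; ClearA; ClearB;
      NotZero; ZeroAB; ZeroA; ZeroB;
      NotInside; InsideAB; InsideB; InsideA;
      NotOne; OneAB; OneB; OneA;
      Bit; NotBitAt; LastBit; NotOdd; Odd; Positive; NotLong; Long;
      LongHalf; LongDrop; LongBack; NextBit; BitHalf; BitRound; BitBack]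
  ++ map Op opcodes.

Definition label_num (p : label) : nat :=
  match p with
  | True_ => 0 | False_ => 1 | Setup => 2
  | Node => 3 | More => 4 | NotBit => 5 | BitAddr => 6 | Edge => 7
  | NotEdge => 8 | EdgeAddrJ => 9 | EdgeAddrL => 10 | Ops => 11
  | Goto => 12 | ClearJ => 13 | LoadJ => 14 | GotoZero => 15 | ClearA => 16
  | ClearB => 17
  | NotZero => 18 | ZeroAB => 19 | ZeroA => 20 | ZeroB => 21
  | NotInside => 22 | InsideAB => 23 | InsideB => 24 | InsideA => 25
  | NotOne => 26 | OneAB => 27 | OneB => 28 | OneA => 29
  | Bit => 30 | NotBitAt => 31 | LastBit => 32 | NotOdd => 33 | Odd => 34
  | Positive => 35 | NotLong => 36 | Long => 37
  | LongHalf => 38 | LongDrop => 39 | LongBack => 40 | NextBit => 41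
  | BitHalf => 42 | BitRound => 43 | BitBack => 44
  | Op o => 44 + opnum o
  end.

Lemma label_num_lt p : label_num p < size labels.
Proof. by case: p => // -[]. Qed.

Lemma label_numK : cancel (fun p => Ordinal (label_num_lt p)) (nth True_ labels).
Proof. by case=> // -[]. Qed.

HB.instance Definition _ := Finite.copy label (can_type label_numK).

(* [rY] is consumed by [Setup], which copies it to [ry] and to the fuel; [rj] is the
   current node, [rl] a guessed input of it, [rt] the time, [ra] and [rb] represent
   the place [ra - rb], [rs] is the index of a binary digit of [ry], and [rh] is
   scratch space for halving. *)
Notation rY := 0 (only parsing).
Notation ry := 1 (only parsing).
Notation rh := 2 (only parsing).
Notation rj := 3 (only parsing).
Notation rl := 4 (only parsing).
Notation rt := 5 (only parsing).
Notation ra := 6 (only parsing).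
Notation rb := 7 (only parsing).
Notation rs := 8 (only parsing).

Definition nreg := 9.
(* More than any increment in [prog], the largest of which is 32. *)
Definition cost := 64.

Definition none : delta := ([::], [::]).
Definition inc (r k : nat) : delta := ([::], [:: (r, k)]).
Definition dec (r k : nat) : delta := ([:: (r, k)], [::]).
Definition mov (r k r' k' : nat) : delta := ([:: (r, k)], [:: (r', k')]).
Definition dec2 (r r' : nat) : delta := ([:: (r, 1); (r', 1)], [::]).

(** The place is [ra - rb], so a step to the left increments [rb]. Resetting the place and testing
    it are left to subprograms. *)
Definition opdelta (o : opcode) : delta :=
  match o with
  | TimeInc => inc rt 1
  | TimeDec => dec rt 1
  | PosInc => inc ra 1
  | PosDec => inc rb 1
  | _ => none
  end.

Definition optest (o : opcode) : seq (delta * label) :=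
  match o with
  | IsZero => [:: (none, NotZero)]
  | IsInside => [:: (none, NotInside)]
  | IsOne => [:: (none, NotOne)]
  | _ => [::]
  end.

(* The digits of [y], most significant first; unlike [bin], empty at [0]. *)
Definition bits (y : nat) : seq bool := bin_aux y y.

Lemma bin_aux_fuel f g n : n <= f -> n <= g -> bin_aux f n = bin_aux g n.
Proof.
elim: f g n => [|f IH] [|g] [|n] //= nf ng; congr rcons.
by apply: IH; rewrite /= ?uphalf_half; lia.
Qed.

Lemma bitsE y : 0 < y -> bits y = rcons (bits y./2) (odd y).
Proof.
case: y => // y _; rewrite {1}/bits /=; congr rcons.
by apply: bin_aux_fuel => //; rewrite uphalf_half; lia.
Qed.

Lemma size_bits_half y s :
  (s.+1 < size (bits y)) = (s < size (bits y./2)).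
Proof. by case: y => // y; rewrite bitsE // size_rcons ltnS. Qed.

Lemma size_bits_gt0 y : (0 < size (bits y)) = (0 < y).
Proof. by case: y => // y; rewrite bitsE // size_rcons. Qed.

(** Halving drops the last digit and keeps the indices of the others, which count from the front;
    [NotBitAt] runs this recursion. *)
Lemma nth_bits_half y s : 0 < y ->
  nth false (bits y) s =
    [&& odd y, s < size (bits y) & ~~ (s.+1 < size (bits y))]
    || nth false (bits y./2) s.
Proof.
move=> y0; rewrite size_bits_half bitsE // nth_rcons size_rcons ltnS.
case: ltngtP => // sl; rewrite ?andbF ?andbT //=.
  by rewrite nth_default ?orbF // ltnW.
by rewrite nth_default ?orbF ?sl.
Qed.

Definition op_test (o : opcode) (bs : seq bool) (x : int) : bool :=
  match o with
  | IsZero => x == 0%R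
  | IsInside => (0 <= x)%R && (absz x < size bs)
  | IsOne => (0 <= x)%R && nth false bs (absz x)
  | _ => true
  end.

Definition op_apply (o : opcode) (bs : seq bool) (t : nat) (x : int) :
    option (nat * int) :=
  match o with
  | TimeInc => Some (t.+1, x)
  | TimeDec => if t is t'.+1 then Some (t', x) else None
  | PosInc => Some (t, x + 1)%R
  | PosDec => Some (t, x - 1)%R
  | PosZero => Some (t, 0%R)
  | _ => if op_test o bs x then Some (t, x) else None
  end.

(* A network evaluates, at each time [t : nat] and place [x : int], every node to
   the NOR of its inputs; entering node [g'] first performs the operation of
   [g'], and the input is dropped when that operation fails. *)
Section Networks.

Variables (node : finType) (nodeop : node -> opcode) (edge : rel node).
Variable bs : seq bool.

Inductive nev : nat -> node -> nat -> int -> bool -> Prop :=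
  | nev_true n g t x :
      (forall g' t' x', edge g g' ->
         op_apply (nodeop g') bs t x = Some (t', x') -> nev n g' t' x' false) ->
      nev n.+1 g t x true
  | nev_false n g t x g' t' x' : edge g g' ->
      op_apply (nodeop g') bs t x = Some (t', x') -> nev n g' t' x' true ->
      nev n.+1 g t x false.

End Networks.

Section Interpreter.

Variables W gain : nat.

(* [Node] is the value of node [rj] restricted to inputs [>= rl]; [More] is true
   iff [rl] is not the last candidate and some larger input is true.  In the
   digits of [y], index [16 * j + 32 * l] tells whether [l] is an input of [j],
   index [16 * l + opnum o] whether [o] is the operation of [l], and index
   [16 * l + 10] whether there are candidates beyond [l].
   [Bit] searches for [e] such that [y / 2 ^ e] is odd and has [rs + 1] digits;
   [Long] compares [rs] with the number of digits by halving [rs] times. *)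
Definition prog (p : label) : instr label :=
  match p with
  | True_ => Nor [::]
  | False_ => Nor [:: (none, True_)]
  | Setup => Branch (mov rY W ry 1) gain Setup Node
  | Node => Nor [:: (none, Edge); (none, More)]
  | More => Nor [:: (inc rs 10, NotBit); (inc rl 1, Node)]
  | NotBit => Nor [:: (none, BitAddr)]
  | BitAddr => Branch (mov rl 1 rs 16) 0 BitAddr Bit
  | Edge => Nor [:: (none, NotEdge); (none, Ops)]
  | NotEdge => Nor [:: (none, EdgeAddrJ)]
  | EdgeAddrJ => Branch (mov rj 1 rs 16) 0 EdgeAddrJ EdgeAddrL
  | EdgeAddrL => Branch (mov rl 1 rs 32) 0 EdgeAddrL Bit
  | Ops => Nor [seq (opdelta o, Op o) | o <- opcodes]
  | Op o => Nor [:: (inc rs (opnum o), NotBit),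
                    (none, if o is PosZero then GotoZero else Goto) & optest o]
  | Goto => Nor [:: (none, ClearJ)]
  | ClearJ => Branch (dec rj 1) 0 ClearJ LoadJ
  | LoadJ => Branch (mov rl 1 rj 1) 0 LoadJ Node
  | GotoZero => Nor [:: (none, ClearA)]
  | ClearA => Branch (dec ra 1) 0 ClearA ClearB
  | ClearB => Branch (dec rb 1) 0 ClearB ClearJ
  | NotZero => Nor [:: (none, ZeroAB)]
  | ZeroAB => Branch (dec2 ra rb) 0 ZeroAB ZeroA
  | ZeroA => Branch (dec ra 1) 0 False_ ZeroB
  | ZeroB => Branch (dec rb 1) 0 False_ True_
  | NotInside => Nor [:: (none, InsideAB)]
  | InsideAB => Branch (dec2 ra rb) 0 InsideAB InsideB
  | InsideB => Branch (dec rb 1) 0 False_ InsideA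
  | InsideA => Branch (mov ra 1 rs 1) 0 InsideA Long
  | NotOne => Nor [:: (none, OneAB)]
  | OneAB => Branch (dec2 ra rb) 0 OneAB OneB
  | OneB => Branch (dec rb 1) 0 False_ OneA
  | OneA => Branch (mov ra 1 rs 1) 0 OneA Bit
  | Bit => Nor [:: (none, NotBitAt)]
  | NotBitAt => Nor [:: (none, LastBit); (dec ry 1, NextBit)]
  | LastBit => Nor [:: (none, NotOdd); (none, NotLong); (inc rs 1, Long)]
  | NotOdd => Nor [:: (none, Odd)]
  | Odd => Branch (dec ry 2) 0 Odd Positive
  | Positive => Branch (dec ry 1) 0 True_ False_
  | NotLong => Nor [:: (none, Long)]
  | Long => Branch (dec rs 1) 0 LongHalf Positive
  | LongHalf => Branch (mov ry 2 rh 1) 0 LongHalf LongDrop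
  | LongDrop => Branch (dec ry 1) 0 LongBack LongBack
  | LongBack => Branch (mov rh 1 ry 1) 0 LongBack Long
  | NextBit => Nor [:: (none, BitHalf)]
  | BitHalf => Branch (mov ry 2 rh 1) 0 BitHalf BitRound
  | BitRound => Branch (mov ry 1 rh 1) 0 BitBack BitBack
  | BitBack => Branch (mov rh 1 ry 1) 0 BitBack NotBitAt
  end.

Lemma prog_loopfree p : loopfree prog p.
Proof.
have H : if prog p is Nor ms then all (fun m => m.2 != p) ms else true.
  by case: p => //; case.
by move: H; rewrite /loopfree; case: (prog p) => // ms /allP.
Qed.

(** Only [Setup] gains fuel, and the [W] units taken from [rY] pay for it; the other instructions
    are checked by computation. *)
Lemma prog_balanced p : gain * cost < W -> balanced_instr nreg cost (prog p).
Proof.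
move=> W_gt.
have [->|pS] := eqVneq p Setup.
  apply: balancedP; rewrite /balancedb /= ?addn0 ?add0n.
  by move: W_gt; rewrite /cost; lia.
have H : match prog p with
    | Nor ms => all (fun m => balancedb nreg cost m.1 0) ms
    | Branch u k _ _ => balancedb nreg cost u k
    end.
  by case: p pS => //; case.
move: H; case: (prog p) => [ms /allP H m /H|u k p1 p2] /=; exact: balancedP.
Qed.

Let ev := ev nreg prog.

Definition regs y h j l t a b s : seq nat := [:: 0; y; h; j; l; t; a; b; s].

Lemma ev_then n m p X u p1 p2 X' b : prog p = Branch u 0 p1 p2 ->
  update nreg u X = Some X' -> ev n p1 X' b -> n + 6 <= m -> ev m p X b.
Proof.
move=> pE uX H nm; apply: ev_mono nm _; apply: ev_branch_then pE uX _.
by rewrite addn0.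
Qed.

Lemma ev_else n m p X u p1 p2 b k : prog p = Branch u k p1 p2 ->
  update nreg u X = None -> ev n p2 X b -> n + 6 <= m -> ev m p X b.
Proof.
by move=> pE uX H nm; apply: ev_mono nm _; apply: ev_branch_else pE uX _.
Qed.

Ltac comp :=
  rewrite /update /fits /shift /mkseq /=
          ?addn0 ?add0n ?subn0 ?leq0n ?subSS ?addn1 ?subn0 /=.
Ltac go_then n := eapply (@ev_then n); [reflexivity | comp; reflexivity | | ].
Ltac go_else n := eapply (@ev_else n); [reflexivity | by comp | | ].

Fixpoint inputs_false (n : nat) (X : seq nat) (ms : seq (delta * label)) : Prop :=
  if ms is m :: ms' then
    (forall X', update nreg m.1 X = Some X' -> ev n m.2 X' false)
    /\ inputs_false n X ms'
  else True.

Lemma ev_norT n m p X ms : prog p = Nor ms -> inputs_false n X ms -> n < m ->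
  ev m p X true.
Proof.
move=> pE H nm; apply: ev_mono nm _; apply: ev_nor_true pE _ => x X'.
elim: ms H => //= x' ms IH [H1 H2]; rewrite inE => /predU1P[->|/IH]; [exact: H1|exact].
Qed.

Lemma ev_norF i n m p X X' ms : prog p = Nor ms -> i < size ms ->
  update nreg (nth (none, True_) ms i).1 X = Some X' ->
  ev n (nth (none, True_) ms i).2 X' true -> n < m -> ev m p X false.
Proof.
move=> pE im aX H nm; apply: ev_mono nm _.
exact: ev_nor_false pE (mem_nth _ im) aX H.
Qed.

Ltac nor_true n :=
  eapply (@ev_norT n);
  [ reflexivity
  | rewrite /=; repeat split; move=> X'; comp; first [discriminate | case=> <-]
  | ].
Ltac nor_false i n :=
  eapply (@ev_norF i n);
  [reflexivity | by [] | comp; reflexivity | rewrite /= | ].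

Lemma ev_not n m p q X b : prog p = Nor [:: (none, q)] -> size X = nreg ->
  ev n q X b -> n < m -> ev m p X (~~ b).
Proof.
move=> pE sX H nm; have aX := update_nil sX; case: b H => H.
  by apply: (@ev_norF 0 n) pE _ aX H nm.
by apply: (@ev_norT n) pE _ nm => //=; split=> // X'; rewrite aX => -[<-].
Qed.

Lemma ev_True n X : 0 < n -> ev n True_ X true.
Proof. by move=> n0; apply: (@ev_norT 0). Qed.

Lemma ev_False n X : size X = nreg -> 1 < n -> ev n False_ X false.
Proof.
by move=> sX n1; apply: (ev_not (n := 1) (b := true)) => //; apply: ev_True.
Qed.

(** * Reading binary digits *)

Lemma long_back n y h j l t a b s v :
  ev n Long (regs (y + h) 0 j l t a b s) v ->
  ev (n + 6 * h + 6) LongBack (regs y h j l t a b s) v.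
Proof.
elim: h y => [|h IH] y H.
  rewrite addn0 in H; go_else n; [exact: H | lia].
go_then (n + 6 * h + 6); last lia.
by apply: IH; rewrite addSnnS.
Qed.

Lemma long_half n y h j l t a b s v :
  ev n LongBack (regs 0 (h + y./2) j l t a b s) v ->
  ev (n + 6 * y./2 + 12) LongHalf (regs y h j l t a b s) v.
Proof.
have [m] := ubnP y; elim: m y h => // m IH [|[|y]] h ym H.
- rewrite addn0 in H; go_else (n + 6); last lia.
  by go_else n; [exact: H | lia].
- rewrite addn0 in H; go_else (n + 6); last by rewrite /=; lia.
  by go_then n; [exact: H | lia].
go_then (n + 6 * y./2 + 12); last by rewrite /=; lia.
apply: IH; first lia.
by rewrite addSnnS.
Qed.

Lemma ev_Positive n y h j l t a b s : 7 < n ->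
  ev n Positive (regs y h j l t a b s) (0 < y).
Proof.
case: y => [|y] n8; first by go_else 2; [apply: ev_False | lia].
by go_then 1; [apply: ev_True | lia].
Qed.

(** Halving [s] times leaves a positive number exactly when there are more than [s] digits. A round
    costs [12 * y./2 + 24], and the first terms sum to at most [12 * y]. *)
Lemma ev_Long y j l t a b s :
  ev (24 * s + 12 * y + 14) Long (regs y 0 j l t a b s) (s < size (bits y)).
Proof.
elim: s y => [|s IH] y.
  by rewrite size_bits_gt0; go_else 8; [apply: ev_Positive | lia].
rewrite size_bits_half.
go_then (24 * s + 12 * y./2 + 14 + 6 * y./2 + 6 + 6 * y./2 + 12); last first.
  have := odd_double_half y; lia.
apply: long_half; apply: long_back; rewrite add0n; exact: IH.
Qed.

Lemma ev_Odd y h j l t a b s :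
  ev (6 * y./2 + 14) Odd (regs y h j l t a b s) (odd y).
Proof.
have [m] := ubnP y; elim: m y => // m IH [|[|y]] ym.
- by go_else 8; [apply: ev_Positive | lia].
- by go_else 8; [apply: ev_Positive | rewrite /=; lia].
go_then (6 * y./2 + 14); last by rewrite /=; lia.
by rewrite /= negbK; apply: IH; lia.
Qed.

Lemma ev_LastBit y j l t a b s :
  ev (24 * s + 12 * y + 50) LastBit (regs y 0 j l t a b s)
    [&& odd y, s < size (bits y) & ~~ (s.+1 < size (bits y))].
Proof.
have Ho : ev (6 * y./2 + 15) NotOdd (regs y 0 j l t a b s) (~~ odd y).
  by apply: ev_not (ev_Odd _ _ _ _ _ _ _ _) _ => //; lia.
have Hl : ev (24 * s + 12 * y + 15) NotLong (regs y 0 j l t a b s) (~~ (s < size (bits y))).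
  by apply: ev_not (ev_Long _ _ _ _ _ _ _) _ => //; lia.
have Hs := ev_Long y j l t a b s.+1.
have hy : y./2 <= y by lia.
have [o|/negbTE o] := boolP (odd y); last first.
  nor_false 0 (6 * y./2 + 15); last lia.
  by rewrite o in Ho.
have [sl|/negbTE sl] := boolP (s < size (bits y)); last first.
  nor_false 1 (24 * s + 12 * y + 15); last lia.
  by rewrite sl in Hl.
have [sl'|/negbTE sl'] := boolP (s.+1 < size (bits y)).
  nor_false 2 (24 * s.+1 + 12 * y + 14); last lia.
  by rewrite sl' in Hs.
nor_true (24 * s + 12 * y + 49); last lia.
- by rewrite o in Ho; apply: ev_mono Ho; lia.
- by rewrite sl in Hl; apply: ev_mono Hl; lia.
- by rewrite sl' in Hs; apply: ev_mono Hs; lia.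
Qed.

Lemma bit_back n y h j l t a b s v :
  ev n NotBitAt (regs (y + h) 0 j l t a b s) v ->
  ev (n + 6 * h + 6) BitBack (regs y h j l t a b s) v.
Proof.
elim: h y => [|h IH] y H.
  rewrite addn0 in H; go_else n; [exact: H | lia].
go_then (n + 6 * h + 6); last lia.
by apply: IH; rewrite addSnnS.
Qed.

(** Rounding up compensates for the decrement made on entering [NextBit]: for positive [y], [uphalf]
    of [y - 1] is [y./2]. *)
Lemma bit_half n y h j l t a b s v :
  ev n BitBack (regs 0 (h + uphalf y) j l t a b s) v ->
  ev (n + 6 * y./2 + 12) BitHalf (regs y h j l t a b s) v.
Proof.
have [m] := ubnP y; elim: m y h => // m IH [|[|y]] h ym H.
- rewrite addn0 in H; go_else (n + 6); last lia.
  by go_else n; [exact: H | lia].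
- rewrite addn1 in H; go_else (n + 6); last by rewrite /=; lia.
  by go_then n; [exact: H | lia].
go_then (n + 6 * y./2 + 12); last by rewrite /=; lia.
apply: IH; first lia.
by rewrite addSnnS.
Qed.

(** Fuel measures a single line of play, so the tests in [LastBit] do not add up over the rounds; as
    [ry] halves each time, the total is linear in [y]. *)
Lemma ev_NotBitAt y j l t a b s :
  ev (24 * s + 100 * y + 60) NotBitAt (regs y 0 j l t a b s)
    (~~ nth false (bits y) s).
Proof.
have [m] := ubnP y; elim: m y => // m IH y ym.
have Hlast := ev_LastBit y j l t a b s.
case: y => [|y] in ym Hlast *.
  rewrite nth_nil; nor_true (24 * s + 12 * 0 + 50); last lia.
  by apply: ev_mono Hlast; lia.
rewrite nth_bits_half //.
set h := y.+1./2; have hE : h = odd y + y./2 by rewrite -uphalf_half.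
have yE := odd_double_half y.
have Hn : ev (24 * s + 106 * h + 6 * y./2 + 79) NextBit (regs y 0 j l t a b s)
    (nth false (bits h) s).
  rewrite -[nth _ _ _]negbK.
  apply: (@ev_not (24 * s + 100 * h + 60 + 6 * h + 6 + 6 * y./2 + 12));
    [by [] | by [] | | lia].
  apply: bit_half; rewrite add0n; apply: bit_back.
  by rewrite add0n; apply: IH; rewrite -/h; lia.
have [lb|/negbTE lb] := boolP [&& _, _ & _].
  rewrite lb in Hlast; nor_false 0 (24 * s + 12 * y.+1 + 50); last lia.
  exact: Hlast.
have [nb|/negbTE nb] := boolP (nth _ _ _).
  rewrite nb in Hn; nor_false 1 (24 * s + 106 * h + 6 * y./2 + 79); last lia.
  exact: Hn.
rewrite lb in Hlast; rewrite nb in Hn.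
nor_true (24 * s + 100 * y.+1 + 59); last lia.
- by apply: ev_mono Hlast; lia.
- by apply: ev_mono Hn; lia.
Qed.

Lemma ev_Bit y j l t a b s :
  ev (24 * s + 100 * y + 61) Bit (regs y 0 j l t a b s) (nth false (bits y) s).
Proof.
rewrite -[nth _ _ _]negbK.
by apply: ev_not (ev_NotBitAt _ _ _ _ _ _ _) _ => //; lia.
Qed.

(** Each round spends 6 and adds 16 to [rs], which costs 24 per unit in the lookup; hence 390. *)
Lemma ev_BitAddr y j l t a b s :
  ev (24 * s + 390 * l + 100 * y + 67) BitAddr (regs y 0 j l t a b s)
    (nth false (bits y) (s + 16 * l)).
Proof.
elim: l s => [|l IH] s.
  by rewrite !muln0 !addn0; go_else (24 * s + 100 * y + 61); [apply: ev_Bit | lia].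
go_then (24 * (s + 16) + 390 * l + 100 * y + 67); last lia.
by rewrite mulnS addnA; apply: IH.
Qed.

Lemma ev_EdgeAddrL y j l t a b s :
  ev (24 * s + 780 * l + 100 * y + 67) EdgeAddrL (regs y 0 j l t a b s)
    (nth false (bits y) (s + 32 * l)).
Proof.
elim: l s => [|l IH] s.
  by rewrite !muln0 !addn0; go_else (24 * s + 100 * y + 61); [apply: ev_Bit | lia].
go_then (24 * (s + 32) + 780 * l + 100 * y + 67); last lia.
by rewrite mulnS addnA; apply: IH.
Qed.

Lemma ev_EdgeAddrJ y j l t a b s :
  ev (24 * s + 390 * j + 780 * l + 100 * y + 73) EdgeAddrJ
    (regs y 0 j l t a b s)
    (nth false (bits y) (s + 16 * j + 32 * l)).
Proof.
elim: j s => [|j IH] s.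
  rewrite !muln0 !addn0; go_else (24 * s + 780 * l + 100 * y + 67); last lia.
  exact: ev_EdgeAddrL.
go_then (24 * (s + 16) + 390 * j + 780 * l + 100 * y + 73); last lia.
by rewrite mulnS addnA; apply: IH.
Qed.

(** * Jumps, tests of the place, and operations *)

Lemma move_l n y j l t a b s v :
  ev n Node (regs y 0 (j + l) 0 t a b s) v ->
  ev (n + 6 * l + 6) LoadJ (regs y 0 j l t a b s) v.
Proof.
elim: l j => [|l IH] j H.
  rewrite addn0 in H; go_else n; [exact: H | lia].
go_then (n + 6 * l + 6); last lia.
by apply: IH; rewrite addSnnS.
Qed.

Lemma clear_j n y j l t a b s v :
  ev n Node (regs y 0 l 0 t a b s) v ->
  ev (n + 6 * l + 6 * j + 12) ClearJ (regs y 0 j l t a b s) v.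
Proof.
elim: j => [|j IH] H.
  go_else (n + 6 * l + 6); last lia.
  by apply: move_l; rewrite add0n.
go_then (n + 6 * l + 6 * j + 12); [exact: IH | lia].
Qed.

Lemma clear_b n y j l t a b s v :
  ev n ClearJ (regs y 0 j l t a 0 s) v ->
  ev (n + 6 * b + 6) ClearB (regs y 0 j l t a b s) v.
Proof.
elim: b => [|b IH] H; first by go_else n; [exact: H | lia].
go_then (n + 6 * b + 6); [exact: IH | lia].
Qed.

Lemma clear_a n y j l t a b s v :
  ev n ClearJ (regs y 0 j l t 0 0 s) v ->
  ev (n + 6 * b + 6 * a + 12) ClearA (regs y 0 j l t a b s) v.
Proof.
elim: a => [|a IH] H.
  by go_else (n + 6 * b + 6); [apply: clear_b | lia].
go_then (n + 6 * b + 6 * a + 12); [exact: IH | lia].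
Qed.

Lemma ev_ZeroAB y j l t a b s :
  ev (6 * a + 20) ZeroAB (regs y 0 j l t a b s) (a == b).
Proof.
elim: a b => [|a IH] [|b].
- go_else 14; last lia.
  go_else 8; last lia.
  by go_else 1; [apply: ev_True | lia].
- go_else 14; last lia.
  go_else 8; last lia.
  by go_then 2; [apply: ev_False | lia].
- go_else 8; last lia.
  by go_then 2; [apply: ev_False | lia].
- by go_then (6 * a + 20); [apply: IH | lia].
Qed.

Lemma ev_InsideA y j l t a b s :
  ev (24 * s + 30 * a + 12 * y + 20) InsideA (regs y 0 j l t a b s)
    (s + a < size (bits y)).
Proof.
elim: a s => [|a IH] s.
  by rewrite addn0; go_else (24 * s + 12 * y + 14); [apply: ev_Long | lia].
go_then (24 * s.+1 + 30 * a + 12 * y + 20); last lia.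
by rewrite -(addSnnS s); apply: IH.
Qed.

Lemma ev_InsideAB y j l t a b :
  ev (30 * a + 12 * y + 32) InsideAB (regs y 0 j l t a b 0)
    ((b <= a) && (a - b < size (bits y))).
Proof.
elim: a b => [|a IH] [|b].
- go_else (12 * y + 26); last lia.
  go_else (12 * y + 20); last lia.
  by apply: ev_mono (ev_InsideA y j l t 0 0 0); lia.
- go_else 8; last lia.
  by go_then 2; [apply: ev_False | lia].
- go_else (30 * a.+1 + 12 * y + 26); last lia.
  go_else (30 * a.+1 + 12 * y + 20); last lia.
  by rewrite subn0; apply: ev_mono (ev_InsideA y j l t a.+1 0 0); lia.
- by go_then (30 * a + 12 * y + 32); [apply: IH | lia].
Qed.

Lemma ev_OneA y j l t a b s :
  ev (24 * s + 30 * a + 100 * y + 67) OneA (regs y 0 j l t a b s)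
    (nth false (bits y) (s + a)).
Proof.
elim: a s => [|a IH] s.
  by rewrite addn0; go_else (24 * s + 100 * y + 61); [apply: ev_Bit | lia].
go_then (24 * s.+1 + 30 * a + 100 * y + 67); last lia.
by rewrite -(addSnnS s); apply: IH.
Qed.

Lemma ev_OneAB y j l t a b :
  ev (30 * a + 100 * y + 79) OneAB (regs y 0 j l t a b 0)
    ((b <= a) && nth false (bits y) (a - b)).
Proof.
elim: a b => [|a IH] [|b].
- go_else (100 * y + 73); last lia.
  go_else (100 * y + 67); last lia.
  by apply: ev_mono (ev_OneA y j l t 0 0 0); lia.
- go_else 8; last lia.
  by go_then 2; [apply: ev_False | lia].
- go_else (30 * a.+1 + 100 * y + 73); last lia.
  go_else (30 * a.+1 + 100 * y + 67); last lia.
  by rewrite subn0; apply: ev_mono (ev_OneA y j l t a.+1 0 0); lia.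
- by go_then (30 * a + 100 * y + 79); [apply: IH | lia].
Qed.

Lemma ev_NotBit y j l t a b s :
  ev (24 * s + 390 * l + 100 * y + 68) NotBit (regs y 0 j l t a b s)
    (~~ nth false (bits y) (s + 16 * l)).
Proof. by apply: ev_not (ev_BitAddr _ _ _ _ _ _ _) _ => //; lia. Qed.

Lemma ev_NotEdge y j l t a b :
  ev (390 * j + 780 * l + 100 * y + 74) NotEdge (regs y 0 j l t a b 0)
    (~~ nth false (bits y) (16 * j + 32 * l)).
Proof.
have H := ev_EdgeAddrJ y j l t a b 0; rewrite add0n in H.
by apply: ev_not H _ => //; lia.
Qed.

Definition zeroed (o : opcode) (a : nat) := if o is PosZero then 0 else a.

Lemma ev_Goto n o y j l t a b v :
  ev n ClearJ (regs y 0 j l t (zeroed o a) (zeroed o b) 0) v ->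
  ev (n + 6 * b + 6 * a + 13) (if o is PosZero then GotoZero else Goto)
    (regs y 0 j l t a b 0) (~~ v).
Proof.
case: o => /= H; do ?[by apply: ev_not H _ => //; lia].
by apply: ev_not (clear_a a b H) _ => //; lia.
Qed.

Lemma ev_optest o q y j l t a b : (none, q) \in optest o ->
  ev (30 * a + 100 * y + 80) q (regs y 0 j l t a b 0)
    (~~ op_test o (bits y) (a%:Z - b%:Z)%R).
Proof.
case: o => //=; rewrite inE => /eqP[->].
- have -> : (a%:Z - b%:Z == 0)%R = (a == b) by lia.
  by apply: ev_not (ev_ZeroAB _ _ _ _ _ _ _) _ => //; lia.
- have -> : (0 <= a%:Z - b%:Z)%R && (absz (a%:Z - b%:Z)%R < size (bits y))
      = (b <= a) && (a - b < size (bits y)).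
    by case: (leqP b a) => ba; [rewrite subzn // | lia].
  by apply: ev_not (ev_InsideAB _ _ _ _ _ _) _ => //; lia.
- have -> : (0 <= a%:Z - b%:Z)%R && nth false (bits y) (absz (a%:Z - b%:Z)%R)
      = (b <= a) && nth false (bits y) (a - b).
    case: (leqP b a) => ba; last by have -> : (0 <= a%:Z - b%:Z)%R = false by lia.
    by rewrite subzn.
  by apply: ev_not (ev_OneAB _ _ _ _ _ _) _ => //; lia.
Qed.

(** An operation splits into a register change, a test and a reset. The growth of [ra + rb] is
    controlled because it bounds the cost of clearing these registers. *)
Lemma op_applyP o y j l t a b :
  match update nreg (opdelta o) (regs y 0 j l t a b 0) with
  | Some X' => exists t' a' b',
      [/\ X' = regs y 0 j l t' a' b' 0, a' + b' <= (a + b).+1 &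
       op_apply o (bits y) t (a%:Z - b%:Z)%R
       = if op_test o (bits y) (a'%:Z - b'%:Z)%R
         then Some (t', (zeroed o a')%:Z - (zeroed o b')%:Z)%R else None]
  | None => op_apply o (bits y) t (a%:Z - b%:Z)%R = None
  end.
Proof.
case: o; comp; try by [exists t, a, b; split].
- by exists t.+1, a, b; split.
- by case: t => [|t] //=; exists t, a, b; split=> //; comp.
- exists t, a.+1, b; split=> //; congr (Some (_, _)); lia.
- exists t, a, b.+1; split; [by []|lia|congr (Some (_, _)); lia].
Qed.

(** [Op o] is a conjunction written as a NOR of negations: the guess [o] is right, the test passes,
    and the node jumped to is true. *)
Lemma op_false m n o y j l t a b : 100 * y + 390 * l + 30 * a + 400 <= m ->
  n + 6 * a + 6 * b + 14 <= m ->
  [\/ nth false (bits y) (opnum o + 16 * l) = false,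
      op_test o (bits y) (a%:Z - b%:Z)%R = false
    | ev n ClearJ (regs y 0 j l t (zeroed o a) (zeroed o b) 0) false] ->
  ev m (Op o) (regs y 0 j l t a b 0) false.
Proof.
move=> ym nm [lo|xo|H].
- have H := ev_NotBit y j l t a b (opnum o); rewrite lo in H.
  nor_false 0 (24 * opnum o + 390 * l + 100 * y + 68); first exact: H.
  have : opnum o <= 9 by case: (o).
  lia.
- have [q qo] : exists q, optest o = [:: (none, q)].
    by move: xo; case: (o) => //= _; eexists.
  have H : ev (30 * a + 100 * y + 80) q (regs y 0 j l t a b 0) true.
    by rewrite -[true]/(~~ false) -xo; apply: ev_optest; rewrite qo inE.
  eapply (@ev_norF 2 (30 * a + 100 * y + 80)); [reflexivity | by rewrite qo | | | lia].
    by rewrite qo; comp; reflexivity.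
  by rewrite qo /=; exact: H.
- have := ev_Goto H => /= {}H.
  by nor_false 1 (n + 6 * b + 6 * a + 13); [exact: H | lia].
Qed.

Lemma op_true m n o y j l t a b : 100 * y + 390 * l + 30 * a + 400 <= m ->
  n + 6 * a + 6 * b + 14 <= m ->
  nth false (bits y) (opnum o + 16 * l) ->
  op_test o (bits y) (a%:Z - b%:Z)%R ->
  ev n ClearJ (regs y 0 j l t (zeroed o a) (zeroed o b) 0) true ->
  ev m (Op o) (regs y 0 j l t a b 0) true.
Proof.
move=> ym nm lo xo H.
have Hb := ev_NotBit y j l t a b (opnum o); rewrite lo in Hb.
have o9 : opnum o <= 9 by case: (o).
have Hg := ev_Goto H; rewrite /= in Hg.
have Ht q : (none, q) \in optest o ->
    ev (30 * a + 100 * y + 80) q (regs y 0 j l t a b 0) false.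
  by move/(@ev_optest o q y j l t a b); rewrite xo.
apply: (@ev_norT m.-1); [reflexivity | | lia].
split; [|split].
- by move=> X'; comp; case=> <-; apply: ev_mono Hb; lia.
- by move=> X'; comp; case=> <-; apply: ev_mono Hg; lia.
move: Ht; case: (o) => //= Ht; split=> // X'; comp; case=> <-;
  by apply: ev_mono (Ht _ _); rewrite ?inE //; lia.
Qed.

(** * Simulation of a network by the interpreter *)

Section RunNetwork.

Variables (node : finType) (nodeop : node -> opcode) (edge : rel node).
Variables (code : node -> nat) (N y : nat).
Hypothesis code_lt : forall g, code g <= N.
Hypothesis op_bit : forall l o, l <= N ->
  nth false (bits y) (opnum o + 16 * l) ->
  exists2 g, code g = l & nodeop g = o.
Hypothesis code_op_bit : forall g,
  nth false (bits y) (opnum (nodeop g) + 16 * code g).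
Hypothesis edge_bit : forall g g',
  nth false (bits y) (16 * code g + 32 * code g') = edge g g'.
Hypothesis more_bit : forall l, l <= N ->
  nth false (bits y) (10 + 16 * l) = (l < N).

Let nev := nev nodeop edge (bits y).

Definition step_cost (B : nat) := 2000 * N + 1000 + 40 * B.

(** A digit lookup leaves the main line of play for good, so [100 * y] is paid once and not once per
    level. A level raises [a + b] by at most one and lowers [n] by one, which preserves the bound
    [B]. *)
Lemma ev_network n g t a b v B : nev n g t (a%:Z - b%:Z)%R v -> a + b + n <= B ->
  ev (100 * y + n.+1 * step_cost B) Node (regs y 0 (code g) 0 t a b 0) v.
Proof.
move Ex: (a%:Z - b%:Z)%R => x H; elim: H a b Ex => {n g t x v}.
- move=> n g t x _ IH a b Ex aB; subst x.
  set c := 100 * y + n.+1 * step_cost B.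
  have cE : 100 * y + n.+2 * step_cost B = c + step_cost B by rewrite /c; lia.
  have c0 : 100 * y + step_cost B <= c by rewrite /c mulSn; lia.
  (* Every guessed operation is wrong, fails, or leads to a false input. *)
  have Hops l : l <= N -> nth false (bits y) (16 * code g + 32 * l) ->
      ev (c + 12 * N + 6 * B + 200) Ops (regs y 0 (code g) l t a b 0) true.
    move=> lN; move=> eb.
    apply: (@ev_mono _ _ _ (c + 12 * N + 6 * B + 199).+1); first lia.
    apply: ev_nor_true => // m X' /mapP[o _ ->] /= oX.
    have := op_applyP o y (code g) l t a b; rewrite oX => -[t' [a' [b' [-> ab]]]].
    have cN := code_lt g.
    move=> oE; apply: (op_false (n := c + 6 * l + 6 * code g + 12)).
    - by rewrite /step_cost in c0; lia.
    - by lia.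
    have [lo|/negbTE] := boolP (nth false (bits y) (opnum o + 16 * l)); last by constructor 1.
    have [g' gl go] := op_bit lN lo; subst l o.
    move: oE; case: ifP => [_ oE|]; last by constructor 2.
    constructor 3; apply: clear_j; apply: (IH g' _ _ _ oE) => //.
      by rewrite -edge_bit.
    by rewrite /zeroed; case: (nodeop g'); lia.
  have Hedge l : l <= N ->
      ev (c + 12 * N + 6 * B + 201) Edge (regs y 0 (code g) l t a b 0) false.
    move=> lN; have He := ev_NotEdge y (code g) l t a b.
    have [e|/negbTE e] := boolP (nth false (bits y) (16 * code g + 32 * l)).
      nor_false 1 (c + 12 * N + 6 * B + 200); last lia.
      exact: Hops.
    rewrite e in He; nor_false 0 (390 * code g + 780 * l + 100 * y + 74).
      exact: He.
    have := code_lt g; rewrite /step_cost in c0; lia.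
  (* Induction on the number [k] of candidates beyond [l]; at [l = N] the unset flag ends the
     scan. *)
  suff Hnode k l : l + k = N ->
      ev (c + 12 * N + 6 * B + 2 * k + 202) Node (regs y 0 (code g) l t a b 0) true.
    rewrite cE; apply: ev_mono (Hnode N 0 (add0n N)).
    rewrite /step_cost; lia.
  elim: k l => [|k IHk] l lk.
    have lN : l <= N by lia.
    nor_true (c + 12 * N + 6 * B + 201); last lia.
      exact: Hedge.
    have Hm := ev_NotBit y (code g) l t a b 10.
    have lN' : (l < N) = false by lia.
    rewrite more_bit // lN' in Hm.
    nor_false 0 (24 * 10 + 390 * l + 100 * y + 68); first exact: Hm.
    rewrite /step_cost in c0; lia.
  nor_true (c + 12 * N + 6 * B + 2 * k + 203); last lia.
    by apply: ev_mono (Hedge l _); lia.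
  nor_false 1 (c + 12 * N + 6 * B + 2 * k + 202); last lia.
  by apply: IHk; lia.
- move=> n g t x g' t' x' gg' oE _ IH a b Ex aB; subst x.
  set c := 100 * y + n.+1 * step_cost B in IH *.
  have cE : 100 * y + n.+2 * step_cost B = c + step_cost B by rewrite /c; lia.
  have c0 : 100 * y + step_cost B <= c by rewrite /c mulSn; lia.
  have cN := code_lt g; have cN' := code_lt g'.
  have Hops : ev (c + 12 * N + 6 * B + 200) Ops
      (regs y 0 (code g) (code g') t a b 0) false.
    have := op_applyP (nodeop g') y (code g) (code g') t a b.
    case aX: update => [X'|]; last by rewrite oE.
    move=> [t1 [a' [b' [XE ab]]]]; rewrite oE; case: ifP => // xo [t1E xE].
    apply: (@ev_mono _ _ _ (c + 12 * N + 6 * B + 199).+1); first lia.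
    apply: (ev_nor_false (m := (opdelta (nodeop g'), Op (nodeop g'))) _ _ aX) => //.
      by apply: (map_f (fun o => (opdelta o, Op o))); case: (nodeop g').
    rewrite XE /= -t1E.
    apply: (op_true (n := c + 6 * code g' + 6 * code g + 12)) => //.
    - by rewrite /step_cost in c0; lia.
    - by lia.
    apply: clear_j; apply: IH => //.
    by rewrite /zeroed; case: (nodeop g'); lia.
  have Hedge : ev (c + 12 * N + 6 * B + 201) Edge
      (regs y 0 (code g) (code g') t a b 0) true.
    have He := ev_NotEdge y (code g) (code g') t a b.
    rewrite edge_bit gg' in He.
    nor_true (c + 12 * N + 6 * B + 200); last lia.
      by apply: ev_mono He; rewrite /step_cost in c0; lia.
    exact: Hops.
  (* The scan climbs only to the true input [code g']; below it all flags are set. *)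
  suff Hnode k l : l + k = code g' ->
      ev (c + 12 * N + 6 * B + 2 * k + 202) Node (regs y 0 (code g) l t a b 0) false.
    rewrite cE; apply: ev_mono (Hnode (code g') 0 (add0n _)).
    rewrite /step_cost; lia.
  elim: k l => [|k IHk] l lk.
    rewrite addn0 in lk; subst l.
    by nor_false 0 (c + 12 * N + 6 * B + 201); [exact: Hedge | lia].
  nor_false 1 (c + 12 * N + 6 * B + 2 * k + 203); last lia.
  have Hm := ev_NotBit y (code g) l t a b 10.
  have lN : l < N by lia.
  rewrite more_bit ?(ltnW lN) // lN in Hm.
  nor_true (c + 12 * N + 6 * B + 2 * k + 202); last lia.
    by apply: ev_mono Hm; rewrite /step_cost in c0; lia.
  by apply: IHk; lia.
Qed.

End RunNetwork.

(** Each round earns [gain] units of fuel and spends 6, so [q] rounds add [(gain - 6) * q]. *)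
Lemma ev_Setup q n y h j l t a b s v : gain * cost < W -> 6 <= gain ->
  ev (n + (gain - 6) * q) Node (regs (y + q) h j l t a b s) v ->
  ev (n + 6) Setup [:: W * q; y; h; j; l; t; a; b; s] v.
Proof.
move=> W_gt gain6; have W0 : 0 < W by apply: leq_ltn_trans W_gt.
elim: q n y => [|q IH] n y H.
  rewrite !muln0 !addn0 in H; rewrite muln0; eapply ev_else; [reflexivity | | exact: H | by []].
   by rewrite /update /fits /= addn0 leqNgt W0.
eapply ev_branch_then; [reflexivity | |]; last first.
  by apply: ev_mono (IH (n + gain - 6) y.+1 _); [lia | rewrite addSnnS; apply: ev_mono H; lia].
  rewrite /update /fits /shift /mkseq /= !addn0 !subn0 addn1 ?leq0n.
  by rewrite mulnS leq_addr addKn.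
Qed.

End Interpreter.

(** * Networks as binary digits *)

(** In base 4 the sum has digit 1 at [a] and 2 at [b], or 3 if they coincide; the induction strips
    the lowest digit. *)
Lemma pow4_inj a b c d : 4 ^ a + 2 * 4 ^ b = 4 ^ c + 2 * 4 ^ d -> a = c /\ b = d.
Proof.
have I x y : 4 ^ x = 4 ^ y -> x = y by move/eqP; rewrite eqn_exp2l // => /eqP.
elim: a b c d => [|a IH] [|b] [|c] [|d]; rewrite ?expn0 ?expnS => E; try lia.
- by split=> //; congr _.+1; apply: I; lia.
- by split=> //; congr _.+1; apply: I; lia.
- have [] : a = c /\ b = d by apply: IH; lia.
  by move=> -> ->.
Qed.

Section Coding.

Variables (node : finType) (nodeop : node -> opcode) (edge : rel node).
Variable start : node.

(* Powers of 4 make [code g + 2 * code g'] determine [g] and [g'], also when the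
   interpreter guesses an [l] that is the code of no node: such an [l] has no
   operation. *)
Definition code (g : node) : nat :=
  if g == start then 1 else 4 ^ (enum_rank g).+1.

Definition code_max : nat := 4 ^ #|node|.

(* Index [0] is set because the leading digit of a number is [1]. *)
Definition code_index (s : nat) : bool :=
  [|| s == 0,
      [exists g, s == opnum (nodeop g) + 16 * code g],
      [exists g, [exists g', edge g g' && (s == 16 * code g + 32 * code g')]]
    | (s %% 16 == 10) && (s %/ 16 < code_max)].

Definition code_bits (L : nat) : seq bool := mkseq code_index L.

Lemma code_inj : injective code.
Proof.
move=> g h; rewrite /code; case: eqP => [->|_]; case: eqP => [->|_] //.
- by rewrite expnS; lia.
- by rewrite expnS; lia.
by move/eqP; rewrite eqn_exp2l // eqSS => /eqP/val_inj/enum_rank_inj.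
Qed.

Lemma code_le g : code g <= code_max.
Proof.
rewrite /code /code_max; case: ifP => _; first by rewrite expn_gt0.
by rewrite leq_exp2l // ltn_ord.
Qed.

Lemma code_pow4 g : exists a, code g = 4 ^ a.
Proof. by rewrite /code; case: ifP => _; [exists 0 | eexists]. Qed.

Variable y : nat.
Hypothesis bitsE : exists2 L, 48 * code_max + 16 <= L & bits y = code_bits L.

Lemma nth_code s : s < 48 * code_max + 16 -> nth false (bits y) s = code_index s.
Proof.
have [L Ls ->] := bitsE => sL.
by rewrite nth_mkseq //; apply: leq_trans sL Ls.
Qed.

(** Residues modulo 16 separate edges from operations and flags, positive codes avoid index 0, and
    [pow4_inj] recovers both ends of the edge. *)
Lemma code_edge_bit g g' :
  nth false (bits y) (16 * code g + 32 * code g') = edge g g'.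
Proof.
have := code_le g; have := code_le g' => ? ?.
have [a aE] := code_pow4 g; have [b bE] := code_pow4 g'.
have g0 : 0 < code g by rewrite aE expn_gt0.
rewrite nth_code; last lia.
rewrite /code_index; apply/idP/idP =>
  [/or4P[/eqP|/existsP[h /eqP]|/existsP[h /existsP[h' /andP[hh' /eqP]]]
        |/andP[/eqP]]|gg'].
- lia.
- have h10 : 0 < opnum (nodeop h) < 10 by case: (nodeop h).
  lia.
- have [c cE] := code_pow4 h; have [d dE] := code_pow4 h'.
  rewrite aE bE cE dE => E.
  have [] : a = c /\ b = d by apply: pow4_inj; lia.
  move=> ac bd; have -> : g = h by apply: code_inj; rewrite aE cE ac.
  by have -> : g' = h' by apply: code_inj; rewrite bE dE bd.
- lia.
- by apply/or4P; constructor 3; apply/existsP; exists g; apply/existsP; exists g';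
    rewrite gg' eqxx.
Qed.

Lemma code_op_bit g :
  nth false (bits y) (opnum (nodeop g) + 16 * code g).
Proof.
have := code_le g => ?; have o10 : 0 < opnum (nodeop g) < 10 by case: (nodeop g).
rewrite nth_code; last lia.
by apply/or4P; constructor 2; apply/existsP; exists g.
Qed.

Lemma op_bit_code l o : l <= code_max ->
  nth false (bits y) (opnum o + 16 * l) ->
  exists2 g, code g = l & nodeop g = o.
Proof.
move=> lN; have o10 : 0 < opnum o < 10 by case: o.
rewrite nth_code; last lia.
case/or4P=> [/eqP|/existsP[h /eqP E]|/existsP[h /existsP[h' /andP[_ /eqP]]]|/andP[/eqP]].
- lia.
- have h10 : 0 < opnum (nodeop h) < 10 by case: (nodeop h).
  exists h; first by lia.
  by apply: (can_inj opnumK); lia.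
- lia.
- lia.
Qed.

Lemma code_more_bit l : l <= code_max ->
  nth false (bits y) (10 + 16 * l) = (l < code_max).
Proof.
move=> lN; rewrite nth_code; last lia.
apply/idP/idP =>
  [/or4P[/eqP|/existsP[h /eqP E]|/existsP[h /existsP[h' /andP[_ /eqP]]]
        |/andP[_]]|lN'].
- lia.
- have h10 : 0 < opnum (nodeop h) < 10 by case: (nodeop h).
  lia.
- lia.
- lia.
- by apply/or4P; constructor 4; lia.
Qed.

End Coding.

(** * Turing machine runs as networks *)

(* The input word is [bits y] followed by the fixed word [tail].  Tapes are read
   relative to their heads, so a head move shifts the whole tape and one step
   is a local rule together with the access to the cells at place 0. *)
Section MachineNetwork.

Variables (M : TM (option bool)) (tail : seq (option bool)).

Let Q := tm_state M.
Let S := tm_gamma M.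
Let I := 'I_(tm_k M).+1.
Let symbols := {ffun I -> S}.

(** As every node is a NOR, facts come with negations: [NotState], [NotCell] and [NotInit] range
    over the ways in which a fact can arise, and [State], [Config], [Update] are NORs of violated
    conditions. *)
Inductive mnode :=
  | Run | Loop | State of Q | NotState of Q | Config of Q & symbols
  | TimeZero | Tick | TimePos
  | NotCell of I & S | NotRead of I & S | Update of Q & symbols & I & S
  | NotSource of Q & symbols & I & S | Origin | OldCell of I & S
  | InitCell of I & S | NotInit of I & S | Always | One | Zero | Inside | Outer
  | NotPrevInside | Suffix of 'I_(size tail) | NotPrevSuffix of 'I_(size tail)
  | Outside.

Definition mnode_code (g : mnode) :
    'I_25 * (Q * symbols * I * S) * option 'I_(size tail) :=
  let q0 := tm_start M in let r0 := [ffun=> tm_blank M] : symbols in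
  let i0 := ord0 : I in let a0 := tm_blank M in
  let c0 := (q0, r0, i0, a0) in
  match g with
  | Run => (@Ordinal 25 0 isT, c0, None)
  | Loop => (@Ordinal 25 1 isT, c0, None)
  | State q => (@Ordinal 25 2 isT, (q, r0, i0, a0), None)
  | NotState q => (@Ordinal 25 3 isT, (q, r0, i0, a0), None)
  | Config q r => (@Ordinal 25 4 isT, (q, r, i0, a0), None)
  | TimeZero => (@Ordinal 25 5 isT, c0, None)
  | Tick => (@Ordinal 25 6 isT, c0, None)
  | TimePos => (@Ordinal 25 7 isT, c0, None)
  | NotCell i a => (@Ordinal 25 8 isT, (q0, r0, i, a), None)
  | NotRead i a => (@Ordinal 25 9 isT, (q0, r0, i, a), None)
  | Update q r i a => (@Ordinal 25 10 isT, (q, r, i, a), None)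
  | NotSource q r i a => (@Ordinal 25 11 isT, (q, r, i, a), None)
  | Origin => (@Ordinal 25 12 isT, c0, None)
  | OldCell i a => (@Ordinal 25 13 isT, (q0, r0, i, a), None)
  | InitCell i a => (@Ordinal 25 14 isT, (q0, r0, i, a), None)
  | NotInit i a => (@Ordinal 25 15 isT, (q0, r0, i, a), None)
  | Always => (@Ordinal 25 16 isT, c0, None)
  | One => (@Ordinal 25 17 isT, c0, None)
  | Zero => (@Ordinal 25 18 isT, c0, None)
  | Inside => (@Ordinal 25 19 isT, c0, None)
  | Outer => (@Ordinal 25 20 isT, c0, None)
  | NotPrevInside => (@Ordinal 25 21 isT, c0, None)
  | Suffix m => (@Ordinal 25 22 isT, c0, Some m)
  | NotPrevSuffix m => (@Ordinal 25 23 isT, c0, Some m)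
  | Outside => (@Ordinal 25 24 isT, c0, None)
  end.

Definition mnode_decode
    (c : 'I_25 * (Q * symbols * I * S) * option 'I_(size tail)) : option mnode :=
  let: (n, (q, r, i, a), o) := c in
  match val n, o with
  | 0, _ => Some Run
  | 1, _ => Some Loop
  | 2, _ => Some (State q)
  | 3, _ => Some (NotState q)
  | 4, _ => Some (Config q r)
  | 5, _ => Some TimeZero
  | 6, _ => Some Tick
  | 7, _ => Some TimePos
  | 8, _ => Some (NotCell i a)
  | 9, _ => Some (NotRead i a)
  | 10, _ => Some (Update q r i a)
  | 11, _ => Some (NotSource q r i a)
  | 12, _ => Some Origin
  | 13, _ => Some (OldCell i a)
  | 14, _ => Some (InitCell i a)
  | 15, _ => Some (NotInit i a)
  | 16, _ => Some Always
  | 17, _ => Some One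
  | 18, _ => Some Zero
  | 19, _ => Some Inside
  | 20, _ => Some Outer
  | 21, _ => Some NotPrevInside
  | 22, Some m => Some (Suffix m)
  | 23, Some m => Some (NotPrevSuffix m)
  | 24, _ => Some Outside
  | _, _ => None
  end.

Lemma mnode_codeK : pcancel mnode_code mnode_decode.
Proof. by case. Qed.

HB.instance Definition _ := Finite.copy mnode (pcan_type mnode_codeK).

Definition transition (q : Q) (r : symbols) : Q * {ffun I -> S * dir} :=
  if halted_state q then (q, [ffun i => (r i, Stay)]) else tm_delta q r.

(** Places are relative to the head: after a move to the right, the cell at [x] is the former cell
    at [x + 1]. *)
Definition dir_op (m : dir) : opcode :=
  match m with MoveL => PosDec | MoveR => PosInc | Stay => Nop end.

Definition mop (g : mnode) : opcode :=
  match g with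
  | Run => TimeInc
  | Config _ _ | Tick | Update _ _ _ _ => TimeDec
  | NotRead _ _ => PosZero
  | NotSource q r i _ => dir_op ((transition q r).2 i).2
  | Origin => IsZero
  | One => IsOne
  | Inside => IsInside
  | NotPrevInside | NotPrevSuffix _ => PosDec
  | _ => Nop
  end.

Definition cell_edge (i : I) (a : S) (h : mnode) : bool :=
  match h with
  | Update _ _ i' a' | InitCell i' a' => (i' == i) && (a' == a)
  | _ => false
  end.

(** The end of [bs] is visible only through [IsInside], so the letters of [tail] are located by a
    chain: [Suffix] 0 holds at an outside place preceded by an inside one, and each later [Suffix]
    follows the one before. *)
Definition medge (g h : mnode) : bool :=
  match g with
  | Run => (h == State (tm_acc M)) || (h == Loop)
  | Loop => (h == State (tm_rej M)) || (h == Run)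
  | State q => h == NotState q
  | NotState q =>
      match h with
      | Config q' r => (transition q' r).1 == q
      | TimeZero => q == tm_start M
      | _ => false
      end
  | Config q r =>
      match h with
      | NotState q' => q' == q
      | NotRead i a => a == r i
      | _ => false
      end
  | TimeZero => h == Tick
  | TimePos => h == TimeZero
  | NotCell i a | NotRead i a => cell_edge i a h
  | Update q r i a =>
      match h with
      | NotState q' => q' == q
      | NotRead i' a' => a' == r i'
      | _ => h == NotSource q r i a
      end
  | NotSource q r i a =>
      (h == OldCell i a) || (h == Origin) && (((transition q r).2 i).1 == a)
  | OldCell i a => (h == Origin) || (h == NotCell i a)
  | InitCell i a => (h == TimePos) || (h == NotInit i a)
  | NotInit i a =>
      if i == ord0 then
        match h with
        | One => tm_input M (Some true) == a
        | Zero => tm_input M (Some false) == a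
        | Suffix m => tm_input M (nth None tail m) == a
        | Outside => tm_blank M == a
        | _ => false
        end
      else (h == Always) && (tm_blank M == a)
  | Zero => (h == Outer) || (h == One)
  | Outer | NotPrevInside => h == Inside
  | Suffix m =>
      match h with
      | Inside | NotPrevInside => val m == 0
      | NotPrevSuffix m' => val m == m'.+1
      | _ => false
      end
  | NotPrevSuffix m => h == Suffix m
  | Outside => if h is Suffix _ then true else h == Inside
  | _ => false
  end.

(** * Semantics of the machine network *)

Variable bs : seq bool.
Hypothesis bs_gt0 : 0 < size bs.

Let w := map Some bs ++ tail.

Definition mstate (t : nat) : Q := (run M w t).1.1.
Definition mcell (t : nat) (i : I) (x : int) : S :=
  (run M w t).1.2 i ((run M w t).2 i + x)%R.
Definition mread (t : nat) : symbols := [ffun i => mcell t i 0%R].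

Lemma mstateS t : mstate t.+1 = (transition (mstate t) (mread t)).1.
Proof.
rewrite /mstate /run iterS -/(run M w t) /step /transition /mread /mcell.
case: (run M w t) => -[q tp] hd /=.
case: ifP => // _.
have -> : [ffun i => tp i (hd i)] = [ffun i => tp i (hd i + 0)%R].
  by apply/ffunP => i; rewrite !ffunE addr0.
by case: tm_delta.
Qed.

Lemma mcellS t i x : mcell t.+1 i x =
  let o := (transition (mstate t) (mread t)).2 i in
  let x' := (x + dir_shift o.2)%R in
  if x' == 0%R then o.1 else mcell t i x'.
Proof.
rewrite /mcell /mstate /run iterS -/(run M w t) /step /transition /mread /mcell.
case: (run M w t) => -[q tp] hd /=.
case: ifP => [_|_] /=.
  by rewrite !ffunE addr0 /=; case: eqP => [->|_]; rewrite ?addr0.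
have -> : [ffun i => tp i (hd i)] = [ffun i => tp i (hd i + 0)%R].
  by apply/ffunP => j; rewrite !ffunE addr0.
case: tm_delta => q' o /=.
have -> : (hd i + dir_shift (o i).2 + x = hd i + (x + dir_shift (o i).2))%R by lia.
by rewrite -[X in _ == X]addr0 (inj_eq (addrI _)).
Qed.

Definition inside (x : int) : bool := (0 <= x)%R && (absz x < size bs).

(* The value of each node after its own operation has been performed. *)
Definition sem (g : mnode) (t : nat) (x : int) : bool :=
  match g with
  | State q => mstate t == q
  | NotState q => mstate t != q
  | Config q r => (mstate t == q) && (mread t == r)
  | TimeZero => t == 0
  | TimePos => t != 0
  | NotCell i a | NotRead i a => mcell t i x != a
  | Update q r i a =>
      [&& mstate t == q, mread t == r & mcell t.+1 i x == a]
  | NotSource q r i a =>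
      (if x == 0%R then ((transition q r).2 i).1 else mcell t i x) != a
  | OldCell i a => (x != 0%R) && (mcell t i x == a)
  | InitCell i a => (t == 0) && (mcell 0 i x == a)
  | NotInit i a => mcell 0 i x != a
  | Zero => inside x && ~~ nth false bs (absz x)
  | Outer | NotPrevInside => ~~ inside x
  | Suffix m => x == (size bs + m)%:Z%R
  | NotPrevSuffix m => x != (size bs + m)%:Z%R
  | Outside => (x < 0)%R || (absz x >= size w)
  | _ => true
  end.

(** A bound on evaluation depth: a machine step takes four levels, through [Update], [NotSource],
    [OldCell] and [NotCell], above the depth of the initial tape, where the [Suffix] chain takes two
    levels per letter. *)
Definition rank (g : mnode) (t : nat) : nat :=
  let s := 2 * size tail in
  match g with
  | TimeZero | Outer | NotPrevInside => 2
  | TimePos | Zero => 3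
  | Suffix m => 3 + 2 * m
  | NotPrevSuffix m => 4 + 2 * m
  | Outside => s + 4
  | NotInit _ _ => s + 5
  | InitCell _ _ => s + 6
  | NotState _ | NotCell _ _ | NotRead _ _ => s + 7 + 4 * t
  | State _ | Config _ _ | OldCell _ _ => s + 8 + 4 * t
  | NotSource _ _ _ _ => s + 9 + 4 * t
  | Update _ _ _ _ => s + 10 + 4 * t
  | _ => 1
  end.

Definition timeless (g : mnode) : bool :=
  match g with Run | Loop => false | _ => true end.

Lemma rank_gt0 g t : 0 < rank g t.
Proof. by case: g => //= *; lia. Qed.

Lemma rank_lt g h t x t' x' : timeless g -> medge g h ->
  op_apply (mop h) bs t x = Some (t', x') -> (timeless h) && (rank h t' < rank g t).
Proof.
have nop (k m : nat) : Some (t, x) = Some (t', x') -> k + 4 * t < m -> k + 4 * t' < m.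
  by case=> <-.
have dec (k m : nat) : match t with 0 => None | u.+1 => Some (u, x) end = Some (t', x') ->
    k + 4 * t < m + 4 -> k + 4 * t' < m.
  by case: t {nop} => // u [<- _]; lia.
case: g => //=.
- by move=> q _ /eqP-> /= /nop; apply; lia.
- move=> q _; case: h => //= [q' r|] _; first by move/dec; apply; lia.
  by move=> _; lia.
- by move=> q r _; case: h => //= [q'|i a] _ []; lia.
- by move=> _ /eqP->.
- by move=> _ /eqP->.
- move=> i a _; case: h => //= [q r i' a'|i' a'] _; first by move/dec; apply; lia.
  by move=> _; lia.
- move=> i a _; case: h => //= [q r i' a'|i' a'] _; first by move/dec; apply; lia.
  by move=> _; lia.
- move=> q r i a _; case: h => //=; do ?by move=> /eqP.
  + by move=> q' _ [<- _]; lia.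
  + by move=> i' a' _ [<- _]; lia.
  + move=> q' r' i' a' /eqP[-> -> -> _].
    by case: ((transition q r).2 i).2 => /= -[<- _]; lia.
- move=> q r i a _ /orP[/eqP->|/andP[/eqP-> _]] /=; first by move/nop; apply; lia.
  by move=> _; lia.
- move=> i a _ /orP[/eqP->|/eqP->] /=; first by move=> _; lia.
  by move/nop; apply; lia.
- by move=> i a _ /orP[/eqP->|/eqP->] /= _; lia.
- move=> i a _; case: eqP => _; last by move=> /andP[/eqP-> _] /= _; lia.
  case: h => //= [||m|] _ _; do ?lia.
  by have := ltn_ord m; lia.
- by move=> _ /orP[/eqP->|/eqP->].
- by move=> _ /eqP->.
- by move=> _ /eqP->.
- move=> m _; case: h => //= m' /eqP-> _; lia.
- by move=> m _ /eqP-> /= _; lia.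
- move=> _; case: h => //=; do ?by move=> /eqP.
    by move=> _ _; lia.
  by move=> m _ _; have := ltn_ord m; lia.
Qed.

Lemma mcell0 i x : mcell 0 i x =
  if (i == ord0) && ((0 <= x)%R && (absz x < size w))
  then tm_input M (nth None w (absz x)) else tm_blank M.
Proof.
rewrite /mcell /= add0r; case: eqP => //= _; case: x => // n /=.
by case: ifP => // nw; rewrite (drop_nth None nw).
Qed.

Lemma nth_w n : nth None w n =
  if n < size bs then Some (nth false bs n) else nth None tail (n - size bs).
Proof.
by rewrite nth_cat size_map; case: ifP => // nb; rewrite (nth_map false).
Qed.

Lemma size_w : size w = size bs + size tail.
Proof. by rewrite size_cat size_map. Qed.

Lemma mreadE t i : mread t i = mcell t i 0%R.
Proof. by rewrite ffunE. Qed.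

(** Together with [sem_false]: on timeless nodes [sem] solves the NOR equations, and as [rank]
    decreases along edges, evaluation must agree with it. *)
Lemma sem_true g t x h t' x' : timeless g -> sem g t x -> medge g h ->
  op_apply (mop h) bs t x = Some (t', x') -> sem h t' x' = false.
Proof.
have cellP i a : mcell t i x != a -> cell_edge i a h ->
    op_apply (mop h) bs t x = Some (t', x') -> sem h t' x' = false.
  move=> ca; case: h => //= [q r i' a'|i' a'] /andP[/eqP-> /eqP->].
    by case: t ca => // t ca [<- <-]; rewrite (negbTE ca) !andbF.
  case=> <- <-; case: t ca => // ca; by rewrite (negbTE ca).
case: g => //=.
- by move=> q _ /eqP qE /eqP-> [<- _] /=; rewrite qE eqxx.
- move=> q _ sq; case: h {cellP} => //= [q' r /eqP qE|/eqP qE].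
    case: t sq => // t; rewrite mstateS => sq [<- _]; apply/negbTE.
    by apply: contra sq => /andP[/eqP-> /eqP->]; rewrite qE.
  by case=> <- _; apply/negbTE; apply: contra sq => /eqP->; rewrite qE.
- move=> q r _ /andP[/eqP qE /eqP rE]; case: h {cellP} => //= [q'|i a] /eqP->.
    by move=> [<- _]; rewrite qE eqxx.
  by move=> [<- <-]; rewrite -rE mreadE eqxx.
- by move=> _ /eqP-> /eqP->.
- by move=> _ tn /eqP-> [<- _]; apply: negbTE.
- by move=> i a _; apply: cellP.
- by move=> i a _; apply: cellP.
- move=> q r i a _ /and3P[/eqP qE /eqP rE /eqP aE]; case: h {cellP} => //=; do ?by move=> /eqP.
  + by move=> q' /eqP-> [<- _]; rewrite qE eqxx.
  + by move=> i' a' /eqP-> [<- <-]; rewrite -rE mreadE eqxx.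
  + move=> q' r' i' a' /eqP[-> -> -> ->]; move: aE; rewrite mcellS qE rE /=.
    move: (transition q r).2 => o; case: (o i).2 => /= aE [<- <-]; rewrite ?addr0 in aE *;
      by rewrite aE eqxx.
- move=> q r i a _ /= sa /orP[/eqP->|/andP[/eqP-> oa]] /=.
    by case=> <- <-; apply/negbTE; apply: contra sa => /andP[/negbTE->].
  by move: sa; case: (x =P 0%R) => //; rewrite oa.
- move=> i a _ /andP[x0 ca] /orP[/eqP->|/eqP->] /=; first by rewrite (negbTE x0).
  by case=> <- <-; rewrite ca.
- move=> i a _ /andP[/eqP-> ca] /orP[/eqP->|/eqP->] /=; first by case=> <- _.
  by case=> _ <-; rewrite ca.
- move=> i a _; rewrite mcell0; case: (i =P ord0) => [_|_] /=; last first.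
    by move=> ca /andP[/eqP-> ca']; rewrite ca' in ca.
  rewrite nth_w size_w; case: h {cellP} => //=.
  + move=> ca ia; case: ifP => // /andP[x0];
    case: (ltnP (absz x) (size bs)) => xb; last by rewrite nth_default.
    by move=> b; move: ca; rewrite x0 xb b ltn_addr //= ia.
  + move=> ca ia [_ <-]; apply/negP => /andP[/andP[x0 xb] /negbTE b].
    by move: ca; rewrite x0 xb b ltn_addr //= ia.
  + move=> m ca ia [_ <-]; apply/negP => /eqP xE; move: ca.
    rewrite xE /= ltn_add2l ltn_ord ltnNge leq_addr /= addKn.
    by rewrite ia.
  + move=> ca ia [_ <-]; apply/negP; rewrite size_w => xo; move: ca.
    by rewrite ifF ?ia //; lia.
- move=> _ /andP[xi b] /orP[/eqP->|/eqP->] /=; first by case=> _ <-; rewrite xi.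
  by rewrite (negbTE b) andbF.
- by move=> _ xi /eqP-> /=; rewrite -/(inside x) (negbTE xi).
- by move=> _ xi /eqP-> /=; rewrite -/(inside x) (negbTE xi).
- move=> m _ /eqP xE; case: h {cellP} => //=.
  + by move=> /eqP m0; rewrite -/(inside x) /inside xE m0 addn0 ltnn andbF.
  + move=> /eqP m0 [_ <-]; rewrite /inside xE m0 addn0; apply/negbF.
    (* Nonemptiness of [bs] puts the place before [size bs] inside. *)
    by have bs0 := bs_gt0; lia.
  + move=> m' /eqP mm [_ <-]; apply/negbF/eqP; rewrite xE mm; lia.
- by move=> m _ xm /eqP-> /= [_ <-]; apply: negbTE.
- move=> _ xo; case: h {cellP} => //=; do ?by move=> /eqP.
    by move: xo; rewrite size_w => xo _; case: ifP => //; lia.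
  by move=> m _ [_ <-]; move: xo; rewrite size_w; have := ltn_ord m; lia.
Qed.

Lemma sem_false g t x : timeless g -> sem g t x = false ->
  exists h t' x', [/\ medge g h, op_apply (mop h) bs t x = Some (t', x')
                    & sem h t' x'].
Proof.
have cellP i a : mcell t i x = a -> exists h t' x',
    [/\ cell_edge i a h, op_apply (mop h) bs t x = Some (t', x') & sem h t' x'].
  case: t => [|t] ca; first by exists (InitCell i a), 0, x; rewrite /= ca !eqxx.
  by exists (Update (mstate t) (mread t) i a), t, x; rewrite /= ca !eqxx.
have readP r : mread t != r -> exists i, mcell t i 0%R != r i.
  move=> rn; apply/existsP; rewrite -negb_forall; apply: contra rn => /forallP H.
  by apply/eqP/ffunP => i; rewrite mreadE; apply/eqP.
case: g => //=.
- by move=> q _ /negbT sq; exists (NotState q), t, x; rewrite /= eqxx.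
- move=> q _ /negbFE/eqP; case: t {cellP readP} => [|t] <-.
    by exists TimeZero, 0, x; rewrite /= eqxx.
  by exists (Config (mstate t) (mread t)), t, x; rewrite /= mstateS !eqxx.
- move=> q r _; case: eqP => [qE /= /negbT rn|/eqP qn _]; last first.
    by exists (NotState q), t, x; rewrite /= eqxx.
  have [i rI] := readP _ rn.
  by exists (NotRead i (r i)), t, 0%R; rewrite /= eqxx.
- by move=> _; case: t {cellP readP} => // t _; exists Tick, t, x.
- by move=> _ /negbFE/eqP->; exists TimeZero, 0, x.
- by move=> i a _ /negbFE/eqP; apply: cellP.
- by move=> i a _ /negbFE/eqP; apply: cellP.
- move=> q r i a _; case: eqP => [qE /=|/eqP qn _]; last first.
    by exists (NotState q), t, x; rewrite /= eqxx.
  case: eqP => [rE /= /negbT|/eqP rn _]; last first.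
    have [i' rI] := readP _ rn.
    by exists (NotRead i' (r i')), t, 0%R; rewrite /= eqxx.
  rewrite mcellS qE rE /= => ca.
  exists (NotSource q r i a), t, (x + dir_shift ((transition q r).2 i).2)%R.
  rewrite /= eqxx; split=> //; case: ((transition q r).2 i).2 => //=; by rewrite addr0.
- move=> q r i a _; case: (x =P 0%R) => [x0|/eqP x0] /negbFE ca.
    by exists Origin, t, x; rewrite /= eqxx ca x0.
  by exists (OldCell i a), t, x; rewrite /= eqxx x0 ca.
- move=> i a _; case: (x =P 0%R) => [x0 _|/eqP x0 /negbT ca].
    by exists Origin, t, x; rewrite /= eqxx x0.
  by exists (NotCell i a), t, x; rewrite /= eqxx ca.
- move=> i a _; case: (t =P 0) => [t0 /negbT ca|/eqP t0 _].
    by exists (NotInit i a), t, x; rewrite /= ca eqxx.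
  by exists TimePos, t, x; rewrite /= eqxx.
- move=> i a _; rewrite mcell0; case: (i =P ord0) => [_|_] /= /negbFE ca; last first.
    by exists Always, t, x; rewrite /= eqxx ca.
  move: ca; rewrite size_w; case: ifP => [/andP[x0 xw]|xw] ca; last first.
    by exists Outside, t, x; rewrite /= size_w ca; split=> //; move/negbT: xw; lia.
  rewrite nth_w in ca; case: ltnP ca => [xb|xb] ca; last first.
    have ms : absz x - size bs < size tail by lia.
    exists (Suffix (Ordinal ms)), t, x; split=> //=; apply/eqP; lia.
  case b: (nth false bs (absz x)) ca => ca.
    by exists One, t, x; rewrite /= x0 b.
  by exists Zero, t, x; rewrite /= /inside x0 xb b.
- move=> _ /nandP[xi|/negbNE b].
    by exists Outer, t, x; rewrite /= eqxx xi.
  have [xi|xi] := boolP (inside x); last by exists Outer, t, x; rewrite /= eqxx xi.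
  by exists One, t, x; rewrite /= eqxx b; case/andP: xi => ->.
- by move=> _ /negbFE xi; exists Inside, t, x; rewrite /= ?eqxx -/(inside x) xi.
- by move=> _ /negbFE xi; exists Inside, t, x; rewrite /= ?eqxx -/(inside x) xi.
- move=> [[|m] ms] _ /negbT /= xm.
    have [xi|xi] := boolP (inside x).
      by exists Inside, t, x; rewrite /= ?eqxx -/(inside x) xi.
    exists NotPrevInside, t, (x - 1)%R; split=> //=.
    by move: xi xm; rewrite /inside; lia.
  exists (NotPrevSuffix (Ordinal (ltnW ms))), t, (x - 1)%R; split=> //=.
  by apply: contra xm => /eqP xm; apply/eqP; lia.
- by move=> m _ /negbFE xm; exists (Suffix m), t, x; rewrite /= eqxx.
- move=> _; rewrite size_w => xo; case: (ltnP (absz x) (size bs)) => xb.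
    by exists Inside, t, x; rewrite /= eqxx xb; split=> //; rewrite ifT //; lia.
  have ms : absz x - size bs < size tail by lia.
  by exists (Suffix (Ordinal ms)), t, x; split=> //=; apply/eqP; lia.
Qed.

Lemma nev_mono n m g t x b : n <= m ->
  nev mop medge bs n g t x b -> nev mop medge bs m g t x b.
Proof.
move=> nm H; elim: H m nm => {n g t x b}.
- move=> n g t x _ IH [|m] // nm; apply: nev_true => h t' x' gh hx.
  exact: IH gh hx _ nm.
- move=> n g t x h t' x' gh hx _ IH [|m] // nm.
  exact: nev_false gh hx (IH _ nm).
Qed.

Lemma nev_sem n g t x : timeless g -> rank g t <= n ->
  nev mop medge bs n g t x (sem g t x).
Proof.
elim: n g t x => [|n IH] g t x tg gn; first by have := rank_gt0 g t; lia.
have IHh h t' x' : medge g h -> op_apply (mop h) bs t x = Some (t', x') ->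
    nev mop medge bs n h t' x' (sem h t' x').
  by move=> gh hx; have /andP[th rh] := rank_lt tg gh hx; apply: IH => //; lia.
case gx: (sem g t x).
  apply: nev_true => h t' x' gh hx.
  by have := IHh _ _ _ gh hx; rewrite (sem_true tg gx gh hx).
have [h [t' [x' [gh hx hs]]]] := sem_false tg gx.
by have := IHh _ _ _ gh hx; rewrite hs; apply: nev_false gh hx.
Qed.

Lemma mstate_halted t s : halted (run M w t) -> t <= s -> run M w s = run M w t.
Proof.
move=> ht /subnK<-; elim: (s - t) => // k IH.
have step_halted (c : config M) : halted c -> step c = c.
  by case: c => -[q tp] hd; rewrite /halted /= => ->.
have -> : run M w (k.+1 + t) = step (run M w (k + t)) by [].
by rewrite IH step_halted.
Qed.

(* [Run] looks for the first time at which the machine has halted; the recursion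
   goes forward in time and is cut off there, so no bound on the running time
   is needed in advance. *)
Lemma nev_run t k : k <= t -> halted (run M w t) ->
  nev mop medge bs (2 * size tail + 12 + 4 * t + 2 * (t - k)) Run k 0%R
    (mstate t != tm_acc M).
Proof.
move=> kt ht; set c := 2 * size tail + 10 + 4 * t.
have cE j : 2 * size tail + 12 + 4 * t + 2 * j = (c + 2 * j).+2 by rewrite /c; lia.
have Hst q j : j <= t -> nev mop medge bs c (State q) j 0%R (mstate j == q).
  by move=> jt; apply: (@nev_sem c (State q)) => //=; rewrite /c; lia.
rewrite cE; move: kt; move dE: (t - k) => j.
(* Backward from [t]: a halted state settles [Run] at [k], and otherwise [Run] is the double
   negation, through [Loop], of [Run] at [k.+1]. *)
elim: j k dE => [|j IH] k dE kt.
  have -> : k = t by lia.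
  have [sa|sa] := eqVneq (mstate t) (tm_acc M).
    apply: (nev_false (g' := State (tm_acc M)) (t' := t) (x' := 0%R)); rewrite /= ?eqxx //.
    by have := Hst (tm_acc M) t (leqnn t); rewrite sa eqxx; apply: nev_mono; lia.
  have sr : mstate t = tm_rej M.
    by move: ht; rewrite /halted /halted_state -/(mstate t) (negbTE sa) => /eqP.
  apply: nev_true => h t' x' /orP[/eqP->|/eqP->] /= [<- <-].
    by have := Hst (tm_acc M) t (leqnn t); rewrite (negbTE sa); apply: nev_mono; lia.
  apply: (nev_false (g' := State (tm_rej M)) (t' := t) (x' := 0%R)); rewrite /= ?eqxx //.
  by have := Hst (tm_rej M) t (leqnn t); rewrite sr eqxx; apply: nev_mono; lia.
have kt' : k.+1 <= t by lia.
have {IH} := IH k.+1 _ kt'; rewrite [t - _]subnS dE => /(_ erefl) IH.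
have Hloop h t' x' : medge Run h -> op_apply (mop h) bs k 0%R = Some (t', x') ->
  (h, t', x') = (State (tm_acc M), k, 0%R) \/ (h, t', x') = (Loop, k, 0%R).
  by case/orP=> /eqP-> /= [<- <-]; [left | right].
have HR : op_apply (mop Run) bs k 0%R = Some (k.+1, 0%R) by [].
have eqsa := Hst (tm_acc M) k (ltnW kt').
have eqsr := Hst (tm_rej M) k (ltnW kt').
have step_halted : halted (run M w k) -> mstate k = mstate t.
  by move=> hk; rewrite /mstate (mstate_halted hk kt).
have [sa|sa] := eqVneq (mstate k) (tm_acc M).
  have -> : (mstate t != tm_acc M) = false.
    apply/negbTE; rewrite negbK -step_halted ?sa //.
    by rewrite /halted /halted_state -/(mstate k) sa eqxx.
  apply: (nev_false (g' := State (tm_acc M)) (t' := k) (x' := 0%R)); rewrite /= ?eqxx //.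
  by rewrite sa eqxx in eqsa; apply: nev_mono eqsa; lia.
rewrite (negbTE sa) in eqsa.
have [sr|sr] := eqVneq (mstate k) (tm_rej M).
  have -> : (mstate t != tm_acc M) = true.
    rewrite -step_halted // /halted /halted_state -/(mstate k) sr eqxx orbT //.
  rewrite sr eqxx in eqsr.
  apply: nev_true => h t' x' gh /(Hloop _ _ _ gh)[[-> -> ->]|[-> -> ->]].
    by apply: nev_mono eqsa; lia.
  apply: (nev_false (g' := State (tm_rej M)) (t' := k) (x' := 0%R)); rewrite /= ?eqxx //.
  by apply: nev_mono eqsr; lia.
rewrite (negbTE sr) in eqsr.
case vE: (mstate t != tm_acc M) IH => IH.
  apply: nev_true => h t' x' gh /(Hloop _ _ _ gh)[[-> -> ->]|[-> -> ->]].
    by apply: nev_mono eqsa; lia.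
  apply: nev_false HR _; first by rewrite /= ?eqxx ?orbT.
  by apply: nev_mono IH; lia.
apply: (nev_false (g' := Loop) (t' := k) (x' := 0%R)); rewrite /= ?eqxx ?orbT //.
apply: nev_true => h t' x' /orP[/eqP->|/eqP->] /= [<- <-].
  by apply: nev_mono eqsr; lia.
by apply: nev_mono IH; lia.
Qed.

End MachineNetwork.

(** * Diagonalization *)

Definition bits_value (s : seq bool) : nat :=
  foldl (fun v (b : bool) => v.*2 + b) 0 s.

Lemma bits_value_rcons s b : bits_value (rcons s b) = (bits_value s).*2 + b.
Proof. by rewrite /bits_value foldl_rcons. Qed.

Lemma bitsK y : bits_value (bits y) = y.
Proof.
have [m] := ubnP y; elim: m y => // m IH [|y] ym //.
rewrite bitsE // bits_value_rcons IH; last by rewrite /= uphalf_half; lia.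
by rewrite addnC odd_double_half.
Qed.

Lemma bits_rcons v (b : bool) : 0 < v -> bits (v.*2 + b) = rcons (bits v) b.
Proof.
move=> v0; rewrite bitsE; last by rewrite addn_gt0 double_gt0 v0.
by rewrite oddD odd_double oddb halfD doubleK odd_double oddb /=; case: b => /=; rewrite ?addn0.
Qed.

Lemma bits_surj s : exists y, bits y = true :: s.
Proof.
elim/last_ind: s => [|s b [y yE]]; first by exists 1.
have y0 : 0 < y by rewrite -size_bits_gt0 yE.
by exists (y.*2 + b); rewrite bits_rcons // yE.
Qed.

Lemma bits_pow2 k y : 0 < y -> bits (2 ^ k * y) = bits y ++ nseq k false.
Proof.
move=> y0; elim: k => [|k IH]; first by rewrite mul1n cats0.
rewrite expnS -mulnA mul2n -[_.*2]addn0 (bits_rcons false) ?muln_gt0 ?expn_gt0 //.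
by rewrite IH -cats1 -catA -[nseq k.+1 _]/(false :: nseq k false) cat_nseq /ncons -iterSr.
Qed.

Lemma pow2_le_bits s y : s < size (bits y) -> 2 ^ s <= y.
Proof.
elim: s y => [|s IH] y; first by rewrite size_bits_gt0.
by rewrite size_bits_half => /IH; rewrite expnS; have := odd_double_half y; lia.
Qed.

Lemma binE y : 0 < y -> bin y = bits y.
Proof. by case: y. Qed.

Lemma binK : cancel bin bits_value.
Proof. by case=> // y; rewrite binE // bitsK. Qed.

Lemma cat_None_inj (u v : seq bool) p q :
  map Some u ++ None :: p = map Some v ++ None :: q -> u = v /\ p = q.
Proof.
elim: u v => [|a u IH] [|b v] //= []; first by [].
by move=> -> /IH[-> ->].
Qed.

Lemma sep_join_inj (s1 s2 : seq (seq bool)) : size s1 = size s2 ->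
  sep_join (map (map Some) s1) = sep_join (map (map Some) s2) -> s1 = s2.
Proof.
elim: s1 s2 => [|u s1 IH] [|v s2] //= [ss].
case: s1 s2 IH ss => [|u' s1] [|v' s2] //= IH ss.
  by move/(inj_map (@Some_inj _)) => ->.
by case/cat_None_inj=> -> /(IH (v' :: s2) ss) ->.
Qed.

Lemma encode_inj d : injective (@encode d).
Proof.
have encE (x : position d) :
    encode x = sep_join (map (map Some) [seq bin (x i) | i <- enum 'I_d]).
  by rewrite /encode -map_comp.
move=> x y; rewrite !encE => /sep_join_inj; rewrite !size_map => /(_ erefl).
move=> /eq_in_map xy; apply/ffunP => i; apply: (can_inj binK).
by apply: xy; rewrite mem_enum.
Qed.

(** The tail depends on the other coordinates only. It can thus be a constant of the network whose
    wiring later fixes the first coordinate. *)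
Lemma encode_first d (x : position d.+1) : exists tail : seq (option bool),
  forall z : position d.+1, (forall i, i != ord0 -> z i = x i) ->
    encode z = map Some (bin (z ord0)) ++ tail.
Proof.
set s := fun z : position d.+1 =>
  [seq map Some (bin (z i)) | i <- [seq lift ord0 i | i <- enum 'I_d]].
exists (if s x is [::] then [::] else None :: sep_join (s x)) => z zx.
have -> : s x = s z.
  by apply/eq_in_map => _ /mapP[i _ ->]; rewrite zx.
by rewrite /encode enum_ordSl /= -/(s z); case: (s z) => //=; rewrite cats0.
Qed.

Section Assembly.

Variables (omega gain : nat).
(* A digit lookup costs at most [100 * y] and a round of [Setup] costs 6, which
   leaves [y] units of fuel for the simulation. *)
Hypothesis gain_ge : 107 <= gain.
Hypothesis gain_lt : gain * cost < 2 ^ omega.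

Let prg := prog (2 ^ omega) gain.
Let D := diffs nreg cost prg.
Let bal p : balanced_instr nreg cost (prg p) := prog_balanced p gain_lt.
Let lf p : loopfree prg p := prog_loopfree (2 ^ omega) gain p.

(** Register [rj] holds 1, the code of the start node. The fuel covers one branch; further rounds of
    [Setup] live on what they earn. *)
Definition start_pos (Y : nat) : position (game_dim label nreg) :=
  pos nreg (Setup, sub 0) [:: Y; 0; 0; 1; 0; 0; 0; 0; 0] (6 * cost).

Lemma valid_D : valid_diffset D.
Proof. exact: diffs_valid. Qed.

Lemma encode_start : exists tail : seq (option bool),
  forall Y, encode (start_pos Y) = map Some (bin Y) ++ tail.
Proof.
have [tail tailP] := encode_first (start_pos 0 : position (9 + #|{: gate label}|).+1).
exists tail => Y; rewrite [LHS](tailP (start_pos Y)).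
  by rewrite ffunE /= !addn0.
move=> [[|i] iD] // _; rewrite !ffunE /=.
by case: i iD => [|[|[|[|[|[|[|[|i]]]]]]]] iD.
Qed.

Lemma start_value y v n : n <= (gain - 6) * y ->
  ev nreg prg n Node (regs y 0 1 0 0 0 0 0) v ->
  value_at cost prg v (start_pos (2 ^ omega * y)).
Proof.
move=> nE H; apply: (ev_value _ bal lf (n := 6)) => //.
apply: (@ev_Setup _ _ y 0 0 0 1 0 0 0 0 0) => //; first by apply: leq_trans gain_ge.
by apply: ev_mono H.
Qed.

(** The digits of [y] are both the wiring of the network of [M] and the beginning of its input, and
    the position is P exactly when [M] does not accept. The cost is quadratic: linearly many levels,
    each linear in [t]. *)
Lemma machine_value (M : TM (option bool)) (tail : seq (option bool)) :
  let N := code_max (mnode M tail) in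
  exists C, forall L, 48 * N + 16 <= L ->
    exists y, [/\ size (bits y) = L, 0 < y &
      let w := map Some (bits y) ++ tail in forall t,
      halted (run M w t) -> C * (t.+1 * t.+1) <= 2 ^ L.-1 ->
      value_at cost prg ((run M w t).1.1 != tm_acc M)
        (start_pos (2 ^ omega * y))].
Proof.
move=> N; set c := 2 * size tail + 19.
exists (c * (2000 * N + 1000 + 40 * c)) => L LN.
have [y yE] : exists y, bits y = code_bits (@mop M tail) (@medge M tail) (Run M tail) L.
  case: L LN => [|L] _; first by exists 0.
  exact: bits_surj.
have sy : size (bits y) = L by rewrite yE size_mkseq.
have L0 : 0 < L by lia.
have y0 : 0 < y by rewrite -size_bits_gt0 sy.
exists y; split=> // w t ht tL.
have bs0 : 0 < size (bits y) by rewrite size_bits_gt0.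
have H := nev_run bs0 (leq0n t) ht.
have yL : exists2 L, 48 * N + 16 <= L
    & bits y = code_bits (@mop M tail) (@medge M tail) (Run M tail) L by exists L.
have := @ev_network (2 ^ omega) gain _ _ _ (code (Run M tail)) N y (@code_le _ (Run M tail))
  (op_bit_code yL) (code_op_bit yL) (code_edge_bit yL) (code_more_bit yL)
  _ (Run M tail) 0 0 0 _ _ H (leqnn _).
rewrite /code eqxx; apply: start_value.
have yt : 2 ^ L.-1 <= y by apply: pow2_le_bits; rewrite sy; lia.
set nu := 0 + 0 + _; have nuE : nu = 2 * size tail + 12 + 6 * t by rewrite /nu; lia.
have le1 : nu.+1 <= c * t.+1 by rewrite nuE /c; nia.
have le2 : step_cost N nu <= (2000 * N + 1000 + 40 * c) * t.+1.
  by rewrite /step_cost nuE /c; nia.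
have := leq_mul le1 le2; rewrite mulnACA => le3.
have le4 : 101 * y <= (gain - 6) * y by rewrite leq_mul2r; lia.
apply: leq_trans le4; rewrite -[101]/(100 + 1) mulnDl mul1n leq_add2l.
by apply: leq_trans yt; apply: leq_trans tL.
Qed.

End Assembly.

Theorem theorem1 :
  exists (d : nat) (D : seq (diffvec d)),
    0 < d /\ valid_diffset D /\
    forall M : TM (option bool),
      decides M (PLang D) ->
      exists c N : nat, 0 < c /\
        forall n, N <= n ->
          exists w : seq (option bool), size w = n /\
            forall t, halted (run M w t) -> 2 ^ n <= c * t ^ 11.
Proof.
(* The existentials keep these unary numbers from being computed. *)
have [gain gain_ge] : exists gain, 107 <= gain by exists 107.
have [omega gain_lt] : exists omega, gain * cost < 2 ^ omega.
  by exists (gain * cost); apply: ltn_expl.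
exists (game_dim label nreg), (diffs nreg cost (prog (2 ^ omega) gain)).
split=> //; split; first exact: valid_D.
move=> M decM; have [tail0 encE] := encode_start.
(* Multiplying [y] by [2 ^ omega] appends [omega] zeros; counted as part of the tail, they leave
   [bits y] as the prefix. *)
pose tail := nseq omega (Some false) ++ tail0.
have [C HC] := machine_value gain_ge gain_lt M tail.
set N := code_max _ in HC; set k := size tail in HC *.
(* The factor 4 bounds [t.+2 * t.+2] by [t.+1 * t.+1], and [2 ^ k.+1] is the loss from [n] to
   [L.-1]. The summand [C.+1] of the threshold settles [t = 0]. *)
exists (C.+1 * 4 * 2 ^ k.+1), (48 * N + 16 + k + C.+1); split.
  by rewrite !muln_gt0 expn_gt0.
move=> n nN; pose L := n - k.
have LN : 48 * N + 16 <= L by rewrite /L; lia.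
have nE : n = L.-1 + k.+1 by rewrite /L; lia.
have [y [sy y0 Hy]] := HC L LN; set w := map Some (bits y) ++ tail in Hy.
exists w; split; first by rewrite size_cat size_map sy /L; lia.
move=> t ht; rewrite leqNgt; apply/negP => tn.
have posE : encode (start_pos (2 ^ omega * y)) = w.
  rewrite encE binE ?muln_gt0 ?expn_gt0 // bits_pow2 // map_cat map_nseq.
  by rewrite -catA.
have tL : C * (t.+1 * t.+1) <= 2 ^ L.-1.
  move: tn; rewrite nE expnD mulnAC ltn_mul2r => /andP[_ tn].
  case: t {ht} tn => [|t] tn.
    apply: leq_trans (ltnW (ltn_expl L.-1 (isT : 1 < 2))).
    by rewrite /L; lia.
  have t11 : t.+1 * t.+1 <= t.+1 ^ 11 by rewrite (leq_pexp2l (_ : 0 < t.+1) (_ : 2 <= 11)).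
  apply: leq_trans (ltnW tn).
  have : t.+2 * t.+2 <= 4 * (t.+1 * t.+1) by lia.
  by move: (t.+1 ^ 11) t11 => T; nia.
have [dec_halt decP] := decM w.
(* If [M] accepts, the position is both N and P; otherwise it is P, so [M] must accept at some other
   time [s]. *)
have := Hy t ht tL; case: eqP => [acc /= Nw|rej /= Pw].
  have [x [xE Px]] : PLang (diffs nreg cost (prog (2 ^ omega) gain)) w.
    by apply/decP; exists t.
  have xw : x = start_pos (2 ^ omega * y) by apply: encode_inj; rewrite posE.
  by rewrite xw in Px; apply: (Ppos_not_Npos Px Nw).
have [s accs] : exists s, (run M w s).1.1 = tm_acc M.
  by apply/decP; exists (start_pos (2 ^ omega * y)); rewrite posE.
have hs : halted (run M w s) by rewrite /halted /halted_state accs eqxx.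
(* The run is constant from the earlier of the two halting times on. *)
by case: (leqP t s) => [ts|/ltnW regs]; apply: rej;
  [rewrite -(mstate_halted ht ts) | rewrite (mstate_halted hs regs)].
Qed.
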